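(* Let $\mathcal{G}'$ be a minimally rigid graph on vertices $v_1,\dots,v_{n-1}$, where $v_1v_2$ is an edge, and let $\mathcal{G}$ be the minimally rigid graph obtained from $\mathcal{G}'$ by a Henneberg 1-step, i.e. by adding a new vertex $v_n$ together with the two edges $v_nv_i$ and $v_nv_j$ for two distinct vertices $v_i,v_j$ of $\mathcal{G}'$. Fix a generic labelling $\lambda$ of $\mathcal{G}$, let $\mathcal F$ be the set of normalized realizations of $\mathcal{G}$ compatible with $\lambda$, and $\mathcal F'$ the set of normalized realizations of $\mathcal{G}'$ compatible with the restriction of $\lambda$ to the edges of $\mathcal{G}'$. Let $H$ and $\psi\colon H\to \operatorname{Sym}(\mathcal F')$ be as defined in the context. Then, as permutation groups on $\mathcal F$, \[ \operatorname{Gal}(\mathcal{G}) \cong \{ h \in H : \psi(h) \in \operatorname{Gal}(\mathcal{G}') \text{ and } \forall \rho, \rho' \in \mathcal F,\ a_{ijn}(\rho) = a_{ijn}(\rho') \implies a_{ijn}(h\rho) = a_{ijn}(h\rho')\}. \]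
   Context: A graph $\mathcal{G}=(V,E)$ is minimally rigid (Laman) if $|E|=2|V|-3$ and every subgraph $(V',E')$ satisfies $|E'|\le 2|V'|-3$. A Henneberg 1-step adds a new vertex and connects it by edges to two existing vertices. A labelling is a map $\lambda\colon E\to\mathbb C$; a realization is a map $\rho\colon V\to\mathbb C^2$, compatible with $\lambda$ if $\lambda(\{u,v\})=(x_u-x_v)^2+(y_u-y_v)^2$ for every edge $\{u,v\}$, where $\rho(u)=(x_u,y_u)$, $\rho(v)=(x_v,y_v)$. Fix an edge $v_1v_2$ (contained in $\mathcal{G}'$). A labelling is generic if $\lambda(v_1v_2)=1$ and the set $\Lambda$ of all other labels is algebraically independent over $\mathbb Q$. A realization is normalized if $\rho(v_1)=(0,0)$ and $\rho(v_2)=(1,0)$; for a minimally rigid graph there are finitely many normalized compatible realizations. With $\mathbb K=\mathbb Q(\Lambda)$ and $\mathbb E=\mathbb K(C)$, where $C$ is the set of all vertex coordinates of all normalized compatible realizations, the Galois group of the graph is $\operatorname{Gal}(\mathcal{G})=\operatorname{Gal}(\mathbb E/\mathbb K)$; it acts on the set of normalized compatible realizations by $\sigma(\rho)(v)=\sigma(\rho(v))$ (coordinatewise), and is regarded as a permutation group on that set. $\operatorname{Gal}(\mathcal{G}')$ is defined in the same way for $\mathcal{G}'$ with the restricted labelling (whose labels generate the base field $\mathbb Q(\lambda(e): e\in E(\mathcal{G}'))$), viewed as a permutation group on $\mathcal F'$. For $\rho,\rho'\in\mathcal F$ write $\rho\sim\rho'$ if $\rho$ and $\rho'$ agree on $v_1,\dots,v_{n-1}$;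 each class has two elements and the classes correspond bijectively to $\mathcal F'$ via restriction. $H$ is the set of permutations $h$ of $\mathcal F$ such that $\rho\sim\rho'$ implies $h(\rho)\sim h(\rho')$, and $\psi(h)$ is the permutation of $\mathcal F'$ induced by the action of $h$ on the $\sim$-classes. For complex points $p_k=(x_k,y_k)$ the signed area is $a_{p_1p_2p_3}=\tfrac12\big((x_2-x_3)(y_1-y_3)-(x_1-x_3)(y_2-y_3)\big)$, and $a_{ijn}(\rho):=a_{\rho(v_i)\rho(v_j)\rho(v_n)}$. *)

(* Defs.v *)
From mathcomp Require Import all_boot all_order all_algebra.
From mathcomp Require Import boolp classical_sets functions reals complex.
From mathcomp Require Import -(notations) mpoly.

Set Implicit Arguments.
Unset Strict Implicit.
Unset Printing Implicit Defensive.

Import Order.TTheory GRing.Theory Num.Theory.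

Local Open Scope ring_scope.

Section Graphs.
Variable V : finType.
Implicit Types (E F : {set {set V}}) (W : {set V}).

Definition simple_graph E := forall e, e \in E -> #|e| = 2%N.

Definition subgraph W F E := F \subset E /\ (forall e, e \in F -> e \subset W).

(* The sparsity bound is meant for subgraphs with at least two vertices: a
   single vertex never satisfies 0 <= 2 * 1 - 3. *)
Definition minimally_rigid E :=
  (#|E| + 3 = 2 * #|V|)%N /\
  (forall W F, subgraph W F E -> (1 < #|W|)%N -> (#|F| + 3 <= 2 * #|W|)%N).

End Graphs.

(* The new vertex is None. *)
Definition henneberg1 (V : finType) (E : {set {set V}}) (i j : V) :
    {set {set option V}} :=
  ([set Some @: (e : {set V}) | e in E]
     :|: [set [set None; Some i]; [set None; Some j]])%SET.

Section Fields.
Variable C : numFieldType.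
Implicit Types (S K L : set C).

Definition subfield K := divring_closed [in K].

(* Every subfield of C contains Q, so this is Q(S). *)
Definition subfield_gen S : set C :=
  [set x | forall K, subfield K -> (S `<=` K)%classic -> K x]%classic.

(* Elements of Gal(L / K) are represented by maps s : C -> C of which only the
   values on L matter: s and t represent the same element iff {in L, s =1 t}. *)
Definition Galois_group L K : set (C -> C) :=
  [set s | [/\ set_bij L L s,
     {in L &, {morph s : x y / x + y}},
     {in L &, {morph s : x y / x * y}}
     & {in K, s =1 id}]]%classic.

(* The family (f i), i in A, and not merely its image, is independent: in
   particular f is injective on A. *)
Definition alg_independent_over_Q (I : finType) (A : {set I}) (f : I -> C) :=
  forall p : mpoly #|A| rat,
    meval (fun k => f (enum_val k)) (map_mpoly ratr p) = 0 -> p = 0.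

Definition point := (C * C)%type.

Definition map_point (s : C -> C) (p : point) : point := (s p.1, s p.2).

Definition sqdist (p q : point) : C := (p.1 - q.1) ^+ 2 + (p.2 - q.2) ^+ 2.

Definition signed_area (p1 p2 p3 : point) : C :=
  2^-1 * ((p2.1 - p3.1) * (p1.2 - p3.2) - (p1.1 - p3.1) * (p2.2 - p3.2)).

End Fields.

(* A labelling is a function on all sets of vertices; only its values on the
   edges are ever used. *)
Section Realizations.
Variables (C : numFieldType) (V : finType) (E : {set {set V}}) (v1 v2 : V).
Variable lambda : {set V} -> C.

Definition other_edges : {set {set V}} := (E :\ [set v1; v2])%SET.

Definition generic_labelling :=
  lambda [set v1; v2]%SET = 1 /\ alg_independent_over_Q other_edges lambda.

Definition compatible (rho : {ffun V -> point C}) :=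
  [forall u, forall v, ([set u; v]%SET \in E) ==>
    (lambda [set u; v]%SET == sqdist (rho u) (rho v))].

Definition normalized (rho : {ffun V -> point C}) :=
  (rho v1 == (0, 0)) && (rho v2 == (1, 0)).

Definition realizations :=
  {rho : {ffun V -> point C} | compatible rho && normalized rho}.

Definition base_field : set C :=
  subfield_gen [set lambda e | e in [set e | e \in other_edges]]%classic.

Definition coordinates : set C :=
  [set x | exists (rho : realizations) (v : V),
     x = (val rho v).1 \/ x = (val rho v).2]%classic.

Definition coordinate_field : set C :=
  subfield_gen (base_field `|` coordinates)%classic.

Definition Gal : set (C -> C) := Galois_group coordinate_field base_field.

Definition acts_as (s : C -> C) (h : realizations -> realizations) :=
  forall rho v, val (h rho) v = map_point s (val rho v).

Definition Gal_perm : set (realizations -> realizations) :=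
  [set h | exists2 s, Gal s & acts_as s h]%classic.

End Realizations.

Arguments Gal_perm {C V} E v1 v2 lambda _.

Section HennebergStep.
Variables (C : numFieldType) (V : finType) (E : {set {set V}}) (v1 v2 i j : V).
Variable lambda : {set option V} -> C.

Definition restrict_labelling (e : {set V}) : C :=
  lambda (Some @: e)%SET.

Local Notation RG :=
  (realizations (henneberg1 E i j) (Some v1) (Some v2) lambda).
Local Notation RG' := (realizations E v1 v2 restrict_labelling).

Lemma restrict_realization_subproof (rho : RG) :
  let r := [ffun v => val rho (Some v)] in
  compatible E restrict_labelling r && normalized v1 v2 r.
Proof.
case: rho => rho /= /andP[/forallP c n]; apply/andP; split; last first.
  by rewrite /normalized !ffunE.
apply/forallP => u; apply/forallP => v; apply/implyP => uvE.
move/forallP: (c (Some u)) => /(_ (Some v)) /implyP.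
rewrite !ffunE /restrict_labelling imsetU !imset_set1; apply.
rewrite /henneberg1 inE; apply/orP; left; apply/imsetP.
by exists [set u; v]%SET => //; rewrite imsetU !imset_set1.
Qed.

Definition restrict_realization (rho : RG) : RG' :=
  Sub [ffun v => val rho (Some v)] (restrict_realization_subproof rho).

Definition equiv_realizations (rho rho' : RG) :=
  forall v : V, val rho (Some v) = val rho' (Some v).

Definition Hgroup : set (RG -> RG) :=
  [set h : RG -> RG | bijective h /\
     forall rho rho', equiv_realizations rho rho' ->
       equiv_realizations (h rho) (h rho')]%classic.

(* Restriction identifies the classes with RG'. For h in Hgroup, the h-image of the
   class of r lies in a single class, and psi h r is the element of RG' this
   class corresponds to. (The default r of xget is used only if no realization
   restricts to r.) *)
Definition psi (h : RG -> RG) (r : RG') : RG' :=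
  xget r [set restrict_realization (h rho) |
            rho in [set rho | restrict_realization rho = r]]%classic.

Definition area_ijn (rho : RG) : C :=
  signed_area (val rho (Some i)) (val rho (Some j)) (val rho None).

End HennebergStep.

(* Main.v *)
From HB Require Import structures.
From mathcomp Require Import all_boot all_order all_algebra.
From mathcomp Require Import boolp classical_sets functions reals complex.
From mathcomp Require Import -(notations) mpoly.
From mathcomp Require Import polyXY mxpoly zify ring.
Require Import Defs.

Set Implicit Arguments.
Unset Strict Implicit.
Unset Printing Implicit Defensive.

Import Order.TTheory GRing.Theory Num.Theory.

Local Open Scope ring_scope.

(* Write K', L' for the base and coordinate fields of G', a and b for the labels
   of the two new edges, and d for the squared distance of v_i and v_j in a
   realization of G'. As G' has 2|V| - 3 edges, Steinitz exchange between the
   labels and the free coordinates of one realization shows that L' is algebraic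
   over K' and that d <> 0; hence a and b are algebraically independent over L'.
   A realization of G is a realization of G' together with the signed area A of
   the new triangle, whose square is Heron's polynomial in a, b, d. For distinct
   values of d these polynomials are independent modulo squares in L'(a, b): in
   the variable a each has a simple zero that is not a zero of the others. By
   Kummer theory an automorphism of L'/K', extended by a |-> a and b |-> b, can
   then be prolonged with an arbitrary choice of sign for every value of d. The
   condition on areas says precisely that h comes from such a choice of signs. *)

(** * Adjoining elements *)

(** A partial isomorphism of [F] is kept as its graph, a subring of [F * F] closed under division,
    and not as a function. Prolonging it means adjoining a pair, and all that has to be verified is
    coherence: in every pair of the graph both components vanish or neither does. Generic labels are
    adjoined as diagonal pairs, areas as pairs consisting of an area and its prescribed image. A
    function on the coordinate field is extracted from the graph only once all pairs are present.

    The condition [d <> 0] is a genuine obstacle: over an algebraically closed field distinct points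
    can have squared distance zero, and then the area no longer determines the new vertex. It is
    excluded by a count: the labels are as many as the free coordinates, so no free coordinate can
    be algebraic over the others. *)

Section Adjoin.
Variable R : comUnitRingType.
Implicit Types (K L : divringClosed R) (x z : R).

(** Denominators are required to be units because the construction also runs in the product ring
    [F * F], which has zero divisors. *)
Definition adjoin K z : {pred R} := fun x => `[< exists p q : {poly R},
  [/\ p \is a polyOver K, q \is a polyOver K, q.[z] \is a GRing.unit
    & x = p.[z] / q.[z]] >].

Lemma adjoinP K z x : reflect (exists p q : {poly R},
  [/\ p \is a polyOver K, q \is a polyOver K, q.[z] \is a GRing.unit
    & x = p.[z] / q.[z]]) (x \in adjoin K z).
Proof. exact: asboolP. Qed.

Lemma adjoin_horner K z p : p \is a polyOver K -> p.[z] \in adjoin K z.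
Proof.
move=> pK; apply/adjoinP; exists p, 1.
by rewrite hornerC divr1 unitr1 rpred1.
Qed.

Fact adjoin_divring K z : divring_closed (adjoin K z).
Proof.
split.
- by rewrite -(hornerC 1 z) adjoin_horner ?rpred1.
- move=> _ _ /adjoinP[p [q [pK qK uq ->]]] /adjoinP[p' [q' [p'K q'K uq' ->]]].
  apply/adjoinP; exists (p * q' - p' * q), (q * q').
  rewrite rpredB ?rpredM // hornerM unitrM uq uq' !hornerE; split=> //.
  rewrite invrM // mulrBl; congr (_ - _); first by rewrite mulrA mulrK.
  by rewrite [q'.[z]^-1 * _]mulrC mulrA mulrK.
- move=> _ _ /adjoinP[p [q [pK qK uq ->]]] /adjoinP[p' [q' [p'K q'K uq' ->]]].
  (* A nonunit is its own inverse by convention, so dividing by [p'.[z] / q'.[z]] means multiplying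
     by it when [p'.[z]] is not a unit. *)
  case: (boolP (p'.[z] \is a GRing.unit)) => up'; apply/adjoinP; last first.
    exists (p * p'), (q * q'); rewrite ?rpredM // !hornerM unitrM uq uq'.
    split=> //; rewrite [(p'.[z] / _)^-1]invr_out ?unitrMl ?unitrV // invrM //.
    by rewrite mulrACA [_^-1 * _^-1]mulrC.
  exists (p * q'), (q * p'); rewrite ?rpredM // !hornerM unitrM uq up'.
  split=> //; rewrite !invrM ?unitrV // invrK.
  by rewrite mulrACA [_^-1 * _^-1]mulrC.
Qed.
HB.instance Definition _ K z :=
  GRing.isDivringClosed.Build R (adjoin K z) (adjoin_divring K z).

Lemma adjoin_sub K z : {subset K <= adjoin K z}.
Proof.
by move=> x xK; rewrite -[x](hornerC _ z) adjoin_horner ?polyOverC.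
Qed.

Lemma adjoin_gen K z : z \in adjoin K z.
Proof. by rewrite -{1}[z]hornerX adjoin_horner ?polyOverX. Qed.

Lemma adjoin_min K L z : {subset K <= L} -> z \in L -> {subset adjoin K z <= L}.
Proof.
move=> KL zL x /adjoinP[p [q [/polyOverP pK /polyOverP qK _ ->]]].
by rewrite rpred_div // rpred_horner //; apply/polyOverP => k; apply: KL.
Qed.

(** The head of the list is adjoined last, so induction on the list peels off the top extension. *)
Definition adjoins K (s : seq R) : divringClosed R :=
  foldr (fun z (L : divringClosed R) => adjoin L z) K s.

Lemma adjoins_base K s : {subset K <= adjoins K s}.
Proof. by elim: s => //= z s IH x /IH; apply: adjoin_sub. Qed.

Lemma adjoins_mem K s : {subset s <= adjoins K s}.
Proof.
elim: s => //= z s IH x; rewrite inE => /predU1P[->|/IH]; first exact: adjoin_gen.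
exact: adjoin_sub.
Qed.

Lemma adjoins_min K L s :
  {subset K <= L} -> {subset s <= L} -> {subset adjoins K s <= L}.
Proof.
move=> KL; elim: s => //= z s IH sL; apply: adjoin_min.
  by apply: IH => x xs; apply: sL; rewrite inE xs orbT.
by apply: sL; rewrite mem_head.
Qed.

Lemma adjoins_subset K s t :
  {subset s <= t} -> {subset adjoins K s <= adjoins K t}.
Proof.
move=> st; apply: adjoins_min; first exact: adjoins_base.
by move=> x /st; apply: adjoins_mem.
Qed.

Lemma horner_quadratic K z p : z ^+ 2 \in K -> p \is a polyOver K ->
  exists u v, [/\ u \in K, v \in K & p.[z] = u + v * z].
Proof.
move=> z2; elim/poly_ind: p => [|p c IH pcK].
  by exists 0, 0; rewrite rpred0 hornerC mul0r addr0.
have [|u [v [uK vK e]]] := IH.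
  apply/polyOverP => k; move/polyOverP: pcK => /(_ k.+1).
  by rewrite coefD coefMX coefC addr0.
have cK : c \in K.
  by move/polyOverP: pcK => /(_ 0%N); rewrite coefD coefMX coefC add0r.
exists (v * z ^+ 2 + c), u; split=> //; first by rewrite rpredD // (rpredM vK z2).
by rewrite hornerMXaddC e; ring.
Qed.

End Adjoin.

Arguments adjoins {R} K s : simpl never.

Definition subfield_closed (R : numFieldType) (K : set R) (KS : subfield K) :
    divringClosed R :=
  HB.pack ([in K] : {pred R}) (GRing.isDivringClosed.Build R [in K] KS).

Lemma mem_subfield_closed (R : numFieldType) (K : set R) (KS : subfield K) x :
  (x \in subfield_closed KS) = (x \in K).
Proof. by []. Qed.

Lemma closed_subfield (R : numFieldType) (K : divringClosed R) :
  subfield [set` K].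
Proof.
split=> [|x y|x y]; rewrite !inE /=; first exact: rpred1.
- exact: rpredB.
- exact: rpred_div.
Qed.

(** * Algebraic elements and Steinitz exchange *)

(** Lifts a polynomial with fractional coefficients to one over [D]. It serves twice: with [D] the
    univariate polynomials, for the exchange property, and with [D] the polynomials in the labels,
    for independence. *)
Lemma clear_denominators (D : comNzRingType) (F : fieldType)
    (ev : {rmorphism D -> F}) (S : {pred D}) (p : {poly F}) :
    0 \in S -> mulr_closed S ->
    (forall k, exists u v, [/\ u \in S, v \in S, ev v != 0 & p`_k = ev u / ev v]) ->
  exists (P : {poly D}) (w : D),
    [/\ forall k, P`_k \in S, w \in S, ev w != 0 & map_poly ev P = ev w *: p].
Proof.
move=> S0 [S1 SM]; elim/poly_ind: p => [_|p c IH pcS].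
  exists 0, 1; rewrite rmorph1 oner_neq0 S1 rmorph0 scaler0.
  by split=> // k; rewrite coef0.
have [|P [w [PS wS w0 eP]]] := IH.
  by move=> k; have := pcS k.+1; rewrite coefD coefMX coefC addr0.
have := pcS 0%N; rewrite coefD coefMX coefC add0r /= => -[u [v [uS vS v0 ->]]].
exists (P * v%:P * 'X + (w * u)%:P), (w * v).
rewrite rmorphM mulf_neq0 ?SM //; split=> // [k|].
  rewrite coefD coefMX coefC coefMC.
  by case: k => [|k] /=; rewrite ?add0r ?addr0 SM.
rewrite rmorphD !rmorphM /= map_polyX !map_polyC /= eP.
by rewrite -[in LHS](divfK v0 (ev u)) -!mul_polyC !polyCM; ring.
Qed.

Section Algebraic.
Variable F : fieldType.
Implicit Types (K L : divringClosed F) (x y : F) (s t : seq F).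

Definition algebraic_over K : {pred F} := fun x => `[< exists p : {poly F},
  [/\ p \is a polyOver K, p != 0 & root p x] >].

Lemma algebraic_overP K x : reflect (exists p : {poly F},
  [/\ p \is a polyOver K, p != 0 & root p x]) (x \in algebraic_over K).
Proof. exact: asboolP. Qed.

(** A subfield given by a predicate becomes a field type, so that the theory of [algebraicOver]
    applies to it. *)
Inductive subfield_type K := SubfieldElt x & x \in K.
Definition subfield_val K (u : subfield_type K) :=
  let: SubfieldElt x _ := u in x.
HB.instance Definition _ K := [isSub for @subfield_val K].
HB.instance Definition _ K := [Choice of subfield_type K by <:].
HB.instance Definition _ K := [SubChoice_isSubUnitRing of subfield_type K by <:].
HB.instance Definition _ K := [SubNzRing_isSubComNzRing of subfield_type K by <:].
HB.instance Definition _ K :=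
  [SubComUnitRing_isSubIntegralDomain of subfield_type K by <:].
HB.instance Definition _ K :=
  [SubIntegralDomain_isSubField of subfield_type K by <:].

Lemma polyOver_subfield_type K (p : {poly F}) : p \is a polyOver K ->
  exists q : {poly subfield_type K}, p = map_poly val q.
Proof.
move=> /polyOverP pK; exists (\poly_(k < size p) Sub p`_k (pK k)).
apply/polyP => k; rewrite coef_map coef_poly; case: ltnP => //= ps.
by rewrite nth_default.
Qed.

Lemma algebraic_overE K x :
  x \in algebraic_over K <-> algebraicOver (val : subfield_type K -> F) x.
Proof.
split=> [/algebraic_overP[p [pK p0 px]]|[p p0 px]].
  have [q e] := polyOver_subfield_type pK; exists q; rewrite -?e //.
  by apply: contraNneq p0 => q0; rewrite e q0 rmorph0.
apply/algebraic_overP; exists (map_poly val p); rewrite px map_poly_eq0 p0.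
by split=> //; apply/polyOverP => k; rewrite coef_map; exact: valP.
Qed.

Fact algebraic_over_divring K : divring_closed (algebraic_over K).
Proof.
split=> [|x y|x y].
- exact/algebraic_overE/(algebraic1 val).
- move=> /algebraic_overE Kx /algebraic_overE Ky.
  exact/algebraic_overE/algebraic_sub.
- move=> /algebraic_overE Kx /algebraic_overE Ky.
  exact/algebraic_overE/algebraic_div.
Qed.
HB.instance Definition _ K :=
  GRing.isDivringClosed.Build F (algebraic_over K) (algebraic_over_divring K).

Lemma algebraic_over_sub K : {subset K <= algebraic_over K}.
Proof.
move=> x xK; apply/algebraic_overP; exists ('X - x%:P).
by rewrite polyOverXsubC polyXsubC_eq0 root_XsubC.
Qed.

Lemma algebraic_over_subset K L :
  {subset K <= L} -> {subset algebraic_over K <= algebraic_over L}.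
Proof.
move=> KL x /algebraic_overP[p [/polyOverP pK p0 px]].
apply/algebraic_overP; exists p.
by split=> //; apply/polyOverP => k; apply: KL.
Qed.

(** Over a field algebraic and integral elements coincide, and a root of a nonzero polynomial with
    integral coefficients is integral. *)
Lemma algebraic_over_idem K :
  {subset algebraic_over (algebraic_over K) <= algebraic_over K}.
Proof.
move=> x /algebraic_overP[p [/polyOverP pK p0 px]].
apply/algebraic_overE/integral_algebraic; apply: integral_root p0 px _.
by move=> _ /(nthP 0)[k _ <-]; apply/integral_algebraic/algebraic_overE/pK.
Qed.

(** Clearing denominators in the equation of [x] over [K(y)] gives a bivariate relation over [K].
    Read as an equation for [y] over [K(x)], it stays nontrivial because [x] is transcendental over
    [K]. *)
Lemma algebraic_over_exchange K x y : x \in algebraic_over (adjoin K y) ->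
  x \notin algebraic_over K -> y \in algebraic_over (adjoin K x).
Proof.
case/algebraic_overP => p [pK p0 px] xK.
have [|||P [w [PK wK w0 eP]]] :=
    @clear_denominators _ _ (horner_eval y) (polyOver K : {pred {poly F}}) p.
- by rewrite rpred0.
- by split=> [|u v]; [exact: rpred1|exact: rpredM].
- move=> k; have /adjoinP[u [v [uK vK v0 ->]]] := polyOverP pK k.
  by exists u, v; rewrite -unitfE.
(* The outer variable of [P] stands for [x] and the inner one for [y]; in [Q] the roles are
   exchanged. *)
pose Q := swapXY P.
have QK k : Q`_k \is a polyOver K.
  apply/polyOverP => l; rewrite coef_swapXY; exact: (polyOverP (PK l)).
apply/algebraic_overP; exists (map_poly (horner_eval x) Q); split.
- by apply/polyOverP => k; rewrite coef_map adjoin_horner.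
- apply: contraNneq xK => Q0.
  have [k Qk] : exists k, Q`_k != 0.
    exists (size Q).-1; rewrite -/(lead_coef Q) lead_coef_eq0 swapXY_eq0.
    apply: contraNneq p0 => P0; move/eqP: eP; rewrite P0 rmorph0 eq_sym.
    by rewrite scaler_eq0 (negPf w0).
  apply/algebraic_overP; exists Q`_k; split=> //.
  by move/polyP: Q0 => /(_ k); rewrite coef_map coef0 => /eqP.
- rewrite /root -horner_swapXY swapXYK -horner2_swapXY horner_swapXY.
  by rewrite [map_poly _ _]eP hornerZ (rootP px) mulr0.
Qed.

End Algebraic.

(** * Exchange and dimension count *)

Section Steinitz.
Variables (F : fieldType) (K : divringClosed F).
Implicit Types (x y : F) (s t : seq F).

Definition alg_span s : divringClosed F := algebraic_over (adjoins K s).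

Lemma alg_span_mem s : {subset s <= alg_span s}.
Proof. by move=> x xs; apply/algebraic_over_sub/adjoins_mem. Qed.

Lemma alg_span_base s : {subset K <= alg_span s}.
Proof. by move=> x xs; apply/algebraic_over_sub/adjoins_base. Qed.

Lemma alg_span_subset s t : {subset s <= t} -> {subset alg_span s <= alg_span t}.
Proof. by move=> st; apply/algebraic_over_subset/adjoins_subset. Qed.

Lemma alg_span_min s t :
  {subset s <= alg_span t} -> {subset alg_span s <= alg_span t}.
Proof.
move=> st x xs; apply: algebraic_over_idem; apply: algebraic_over_subset xs.
exact/adjoins_min/st/alg_span_base.
Qed.

Fixpoint alg_free s : bool :=
  if s is x :: s' then (x \notin alg_span s') && alg_free s' else true.

(** Elements are dropped from the front of [t] until [y] ceases to be algebraic over the rest; the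
    element dropped at that moment can be traded for [y]. *)
Lemma alg_span_replace y s t : y \in alg_span (s ++ t) -> y \notin alg_span s ->
  exists2 t', (size t').+1 = size t & {subset t <= alg_span (y :: s ++ t')}.
Proof.
elim: t => [|x t IH]; first by rewrite cats0 => ->.
move=> yst ys; have [yt|nyt] := boolP (y \in alg_span (s ++ t)).
  have [t' st' tt'] := IH yt ys; exists (x :: t'); first by rewrite /= st'.
  move=> z; rewrite inE => /predU1P[->|/tt'].
    by apply: alg_span_mem; rewrite !(inE, mem_cat) eqxx !orbT.
  apply: alg_span_subset => w; rewrite !(inE, mem_cat).
  by case/or3P=> ->; rewrite ?orbT.
exists t => // z; rewrite inE => /predU1P[->|zt]; last first.
  by apply: alg_span_mem; rewrite !(inE, mem_cat) zt !orbT.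
apply: algebraic_over_exchange nyt; move: yst; apply: (@alg_span_subset _ (x :: _)).
by move=> w; rewrite !(inE, mem_cat) orbCA.
Qed.

Lemma steinitz s t : alg_free s -> {subset s <= alg_span t} ->
  exists2 t', (size t' + size s)%N = size t & {subset t <= alg_span (s ++ t')}.
Proof.
elim: s => [_ _|y s IH /= /andP[ys fs] yst].
  by exists t; [rewrite addn0|exact: alg_span_mem].
have [|t' et' tt'] := IH fs; first by move=> x xs; rewrite yst // inE xs orbT.
have [|t'' et'' tt''] := alg_span_replace _ ys (t := t').
  by apply: alg_span_min tt' _ _; rewrite yst ?mem_head.
exists t''; first by rewrite addnS -addSn et''.
move=> x /tt'; apply: alg_span_min => z; rewrite mem_cat => /orP[zs|/tt'' //].
by apply: alg_span_mem; rewrite !(inE, mem_cat) zs !orbT.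
Qed.

Lemma alg_free_span s t : alg_free s -> {subset s <= alg_span t} ->
  size s = size t -> {subset t <= alg_span s}.
Proof.
move=> fs st e; have [t' + tt'] := steinitz fs st.
move/eqP; rewrite e -{2}[size t]add0n eqn_add2r size_eq0 => /eqP t0.
by rewrite t0 cats0 in tt'.
Qed.

(** Otherwise [t] alone would span a free sequence longer than itself. *)
Lemma alg_span_redundant s x t : alg_free s -> {subset s <= alg_span (x :: t)} ->
  size s = (size t).+1 -> x \notin alg_span t.
Proof.
move=> fs st e; apply/negP => xt.
have [|t' + _] := @steinitz s t fs.
  move=> y /st; apply: alg_span_min => z; rewrite inE => /predU1P[->//|].
  exact: alg_span_mem.
by rewrite e => et; have := leq_addl (size t') (size t).+1; rewrite et ltnn.
Qed.

End Steinitz.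

Section Rationals.
Variable F : numFieldType.

Definition rationals : {pred F} := fun x => `[< exists q : rat, x = ratr q >].

Fact rationals_divring : divring_closed rationals.
Proof.
split; first by apply/asboolP; exists 1; rewrite rmorph1.
  by move=> _ _ /asboolP[p ->] /asboolP[q ->]; apply/asboolP; exists (p - q);
    rewrite rmorphB.
by move=> _ _ /asboolP[p ->] /asboolP[q ->]; apply/asboolP; exists (p / q);
    rewrite fmorph_div.
Qed.
HB.instance Definition _ :=
  GRing.isDivringClosed.Build F rationals rationals_divring.

Lemma rationals_min (K : divringClosed F) : {subset rationals <= K}.
Proof.
move=> _ /asboolP[q ->]; by rewrite rpred_div ?rpred_int.
Qed.

End Rationals.

(** * Algebraic independence *)

Section Fractions.
Variables (D : comNzRingType) (F : fieldType) (ev : {rmorphism D -> F}).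
Variable S : subringClosed D.

(** Used with [S] the polynomials avoiding one variable: a subfield containing the values of all the
    other variables. *)
Definition fractions : {pred F} := fun x => `[< exists p q,
  [/\ p \in S, q \in S, ev q != 0 & x = ev p / ev q] >].

Fact fractions_divring : divring_closed fractions.
Proof.
split.
- by apply/asboolP; exists 1, 1; rewrite rpred1 rmorph1 divr1 oner_neq0.
- move=> _ _ /asboolP[p [q [pS qS q0 ->]]] /asboolP[p' [q' [p'S q'S q'0 ->]]].
  apply/asboolP; exists (p * q' - p' * q), (q * q').
  rewrite rpredB ?rpredM // rmorphB !rmorphM /= mulf_neq0 //; split=> //.
  by field; rewrite q0 q'0.
- move=> _ _ /asboolP[p [q [pS qS q0 ->]]] /asboolP[p' [q' [p'S q'S q'0 ->]]].
  apply/asboolP; have [p'0|p'0] := eqVneq (ev p') 0.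
    exists 0, 1; rewrite rpred0 rpred1 rmorph0 rmorph1 oner_neq0 p'0.
    by rewrite !(mul0r, invr0, mulr0).
  exists (p * q'), (q * p'); rewrite ?rpredM // !rmorphM mulf_neq0 //; split=> //.
  by field; rewrite q0 q'0 p'0.
Qed.
HB.instance Definition _ :=
  GRing.isDivringClosed.Build F fractions fractions_divring.

End Fractions.

Definition family_eval (F : numFieldType) (I : finType) (A : {set I}) (f : I -> F)
    (p : mpoly #|A| rat) : F :=
  meval (fun k => f (enum_val k)) (map_mpoly ratr p).
HB.instance Definition _ (F : numFieldType) (I : finType) (A : {set I})
    (f : I -> F) :=
  GRing.RMorphism.copy (@family_eval F I A f)
    (meval (fun k => f (enum_val k)) \o map_mpoly ratr).

(* Regards a polynomial as a univariate polynomial in the variable of index k. *)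
Definition mpoly_single (n : nat) (k : 'I_n) : mpoly n rat -> {poly mpoly n rat} :=
  mmap (polyC \o @mpolyC n rat)
    (fun l => if l == k then 'X else (mpolyX rat (mnm1 l))%:P).
HB.instance Definition _ n (k : 'I_n) := GRing.RMorphism.on (mpoly_single k).

(** The polynomials that avoid the variable [k]: collecting its powers leaves a constant. In this
    form closure under the ring operations follows from the morphism property. *)
Definition mpoly_without (n : nat) (k : 'I_n) : {pred mpoly n rat} :=
  fun p => mpoly_single k p == p%:P.

Fact mpoly_without_subring n (k : 'I_n) : subring_closed (mpoly_without k).
Proof.
split=> [|p q|p q]; rewrite !unfold_in; first by rewrite rmorph1.
  by move=> /eqP ep /eqP eq; rewrite rmorphB /= ep eq polyCB.
by move=> /eqP ep /eqP eq; rewrite rmorphM /= ep eq polyCM.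
Qed.
HB.instance Definition _ n (k : 'I_n) :=
  GRing.isSubringClosed.Build (mpoly n rat) (mpoly_without k)
    (mpoly_without_subring k).

Section AlgebraicIndependence.
Variables (F : numFieldType) (I : finType) (A : {set I}) (f : I -> F).
Hypothesis f_indep : alg_independent_over_Q A f.
Variable k : 'I_#|A|.

(** By independence, an equation for the value of the variable [k] lifts to an identity of
    polynomials; as its coefficients avoid that variable, all of them vanish. *)
Lemma fractions_without_transcendental :
  f (enum_val k) \notin algebraic_over (fractions (family_eval f) (mpoly_without k)).
Proof.
apply/negP => /algebraic_overP[p [/polyOverP pK p0 px]].
have [|||P [w [PK wK w0 eP]]] :=
    @clear_denominators _ _ (family_eval f) (mpoly_without k) p.
- exact: rpred0.
- by split=> [|u v]; [exact: rpred1|exact: rpredM].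
- by move=> l; have /asboolP := pK l.
have : P.[mpolyX rat (mnm1 k)] = 0.
  apply: f_indep; rewrite -/(family_eval f _) -horner_map /= eP.
  have -> : family_eval f (mpolyX rat (mnm1 k)) = f (enum_val k).
    by rewrite /family_eval map_mpolyX mevalXU.
  by rewrite hornerZ (rootP px) mulr0.
move/(congr1 (mpoly_single k)); rewrite -horner_map rmorph0 /=.
have -> : mpoly_single k (mpolyX rat (mnm1 k)) = 'X.
  by rewrite /mpoly_single mmapX mmap1U eqxx.
have -> : map_poly (mpoly_single k) P = map_poly polyC P.
  by apply/polyP => l; rewrite !coef_map /=; exact/eqP/PK.
(* Substituting the variable [k] into [P] and then collecting its powers gives back [P], which is
   therefore zero. *)
rewrite [LHS]comp_polyXr => P0.
move/eqP: eP; rewrite P0 rmorph0 eq_sym scaler_eq0 (negPf w0) /=.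
by apply/negP.
Qed.

End AlgebraicIndependence.

Lemma alg_independent_free (F : numFieldType) (I : finType) (A : {set I})
    (f : I -> F) (s : seq I) : alg_independent_over_Q A f -> uniq s ->
  {subset s <= A} -> alg_free (@rationals F) (map f s).
Proof.
move=> fA; elim: s => //= x s IH /andP[xs us] sA; rewrite IH //; last first.
  by move=> y ys; rewrite sA // inE ys orbT.
rewrite andbT; have xA : x \in A by rewrite sA ?mem_head.
have := fractions_without_transcendental fA (enum_rank_in xA x).
rewrite enum_rankK_in //; apply: contraNN; apply: algebraic_over_subset.
apply: adjoins_min; first exact: rationals_min.
move=> _ /mapP[y ys ->].
have yA : y \in A by rewrite sA // inE ys orbT.
apply/asboolP; exists (mpolyX rat (mnm1 (enum_rank_in xA y))), 1.
rewrite rpred1 rmorph1 divr1 oner_neq0; split=> //; last first.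
  by rewrite /= /family_eval map_mpolyX mevalXU enum_rankK_in.
rewrite unfold_in /mpoly_single mmapX mmap1U ifN //.
by apply: contraNneq xs => /(congr1 enum_val); rewrite !enum_rankK_in // => <-.
Qed.

(** * Graphs of partial field isomorphisms *)

Section PreimageClosed.
Variables (R S : unitRingType) (f : {rmorphism R -> S}) (L : divringClosed S).

(** Applied to the two projections of [F * F]: to locate the components of all pairs of a graph in a
    subfield, it suffices to look at generating pairs. *)
Definition preim_pred : {pred R} := fun x => f x \in L.

Lemma preim_predE x : (x \in preim_pred) = (f x \in L).
Proof. by []. Qed.

Fact preim_pred_divring : divring_closed preim_pred.
Proof.
split=> [|x y|x y]; rewrite !preim_predE ?rmorph1 ?rpred1 // => Lx Ly.
  by rewrite rmorphB rpredB.
rewrite rmorphM rpredM //; have [uy|uy] := boolP (y \is a GRing.unit).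
  by rewrite rmorphV // rpredV.
by rewrite invr_out.
Qed.
HB.instance Definition _ :=
  GRing.isDivringClosed.Build R preim_pred preim_pred_divring.

End PreimageClosed.

Section Coherent.
Variable F : fieldType.
Implicit Types (G : divringClosed (F * F)%type) (L : divringClosed F).

(* A coherent G is the graph of an isomorphism between two subfields of F. *)
Definition coherent G := forall u, u \in G -> (u.1 == 0) = (u.2 == 0).

Lemma pair_unitE (u : F * F) : (u \is a GRing.unit) = (u.1 != 0) && (u.2 != 0).
Proof. by case: u => x y; rewrite -!unitfE. Qed.

Lemma coherent_adjoin G z :
    (forall p, p \is a polyOver G -> (p.[z].1 == 0) = (p.[z].2 == 0)) ->
  coherent (adjoin G z).
Proof.
move=> Gz u /adjoinP[p [q [pG qG uq e]]].
have := Gz p pG; rewrite -(divrK uq p.[z]) -e /=.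
move: uq; rewrite pair_unitE !mulf_eq0 => /andP[/negPf-> /negPf->].
by rewrite !orbF.
Qed.

(** Each component of [p.[(x, x)]] is a polynomial over [L] at a transcendental point, so it
    vanishes only if all its coefficients do, and coherence of [G] applies to each coefficient. *)
Lemma coherent_adjoin_transcendental G L x : coherent G ->
    (forall u, u \in G -> (u.1 \in L) && (u.2 \in L)) ->
  x \notin algebraic_over L -> coherent (adjoin G (x, x)).
Proof.
move=> cG GL xL; apply: coherent_adjoin => p /polyOverP pG.
have e1 : p.[(x, x)].1 = (map_poly fst p).[x] by rewrite -(horner_map fst).
have e2 : p.[(x, x)].2 = (map_poly snd p).[x] by rewrite -(horner_map snd).
have trans q : q \is a polyOver L -> (q.[x] == 0) = (q == 0).
  move=> qL; apply/idP/eqP => [qx|->]; last by rewrite horner0.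
  apply: contraNeq xL => q0; apply/algebraic_overP; exists q; split=> //.
rewrite e1 e2 !trans; first last.
- by apply/polyOverP => k; rewrite coef_map; have /andP[] := GL _ (pG k).
- by apply/polyOverP => k; rewrite coef_map; have /andP[] := GL _ (pG k).
apply/eqP/eqP => /polyP p0; apply/polyP => k; have := p0 k;
  rewrite !coef_map !coef0 /= => /eqP e; apply/eqP.
  by rewrite -(cG _ (pG k)).
by rewrite (cG _ (pG k)).
Qed.

(** The last hypothesis says that [z.1] lies outside the domain of the isomorphism, so the first
    component of [u + v * z] vanishes only for [u = v = 0]. *)
Lemma coherent_adjoin_quadratic G z : coherent G -> z ^+ 2 \in G ->
  (forall u, u \in G -> u.1 != z.1) -> coherent (adjoin G z).
Proof.
move=> cG z2 zG; apply: coherent_adjoin => p pG.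
have [u [v [uG vG ->]]] := horner_quadratic z2 pG.
have indep : u.1 + v.1 * z.1 = 0 \/ u.1 - v.1 * z.1 = 0 -> u = 0 /\ v = 0.
  move=> uvz; have v1 : v.1 = 0.
    apply/eqP; case: eqVneq => // v1.
    have uv : v \is a GRing.unit by rewrite pair_unitE -(cG _ vG) v1.
    have e w : w.1 = z.1 * v.1 -> w \in G -> false.
      move=> ew wG; have /negP[] := zG (w / v) (rpred_div wG vG).
      by rewrite -(inj_eq (mulIf v1)) -ew -{2}(divrK uv w).
    case: uvz => [uvz|/subr0_eq uvz].
      apply: (e (- u)); rewrite ?rpredN //= mulrC; apply/eqP.
      by rewrite eqr_oppLR -addr_eq0 uvz.
    by apply: (e u) => //; rewrite mulrC.
  have u1 : u.1 = 0 by case: uvz; rewrite v1 mul0r ?addr0 ?subr0.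
  have := cG _ uG; have := cG _ vG; rewrite u1 v1 eqxx => /esym/eqP v2 /esym/eqP u2.
  by case: (u) u1 u2 => ? ? /= -> ->; case: (v) v1 v2 => ? ? /= -> ->.
apply/eqP/eqP => /= uvz.
  by have [-> ->] := indep (or_introl uvz); rewrite /= mul0r addr0.
(* The hypothesis controls first components. The norm of [u + v * z] lies in [G], where coherence
   carries its vanishing from the second component to the first. *)
have NG : u ^+ 2 - v ^+ 2 * z ^+ 2 \in G.
  by apply: rpredB; [exact: rpredX|apply: rpredM => //; exact: rpredX].
have : (u ^+ 2 - v ^+ 2 * z ^+ 2).2 = 0.
  have -> : u ^+ 2 - v ^+ 2 * z ^+ 2 = (u + v * z) * (u - v * z) by ring.
  by rewrite /= uvz mul0r.
move/eqP; rewrite -(cG _ NG).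
have -> : u ^+ 2 - v ^+ 2 * z ^+ 2 = (u + v * z) * (u - v * z) by ring.
by rewrite /= mulf_eq0 => /orP[] /eqP uvz1; have [|-> ->] := indep;
  rewrite /= ?mul0r ?addr0; tauto.
Qed.

End Coherent.

(** * Quadratic extensions and Kummer theory of exponent two *)

Lemma adjoin_quadraticP (F : fieldType) (K : divringClosed F) (x z : F) :
    z ^+ 2 \in K -> z \notin K -> x \in adjoin K z ->
  exists u v, [/\ u \in K, v \in K & x = u + v * z].
Proof.
move=> z2 zK /adjoinP[p [q [pK qK q0 ->]]].
have [u [v [uK vK ->]]] := horner_quadratic z2 pK.
have [u' [v' [u'K v'K eq]]] := horner_quadratic z2 qK.
rewrite unitfE eq in q0; rewrite eq.
(* The conjugate of the denominator, by which the fraction is rationalised; if it vanished, [z]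
   would lie in [K]. *)
have q1 : u' - v' * z != 0.
  apply: contraNneq zK => /subr0_eq e; have [v0|v0] := eqVneq v' 0.
    by move: q0; rewrite e v0 !mul0r addr0 eqxx.
  by rewrite -(mulKf v0 z) -e rpredM ?rpredV.
have eN : u' ^+ 2 - v' ^+ 2 * z ^+ 2 = (u' + v' * z) * (u' - v' * z) by ring.
have NK : u' ^+ 2 - v' ^+ 2 * z ^+ 2 \in K.
  by rewrite rpredB // ?(rpredM (rpredX _ v'K) z2) ?rpredX.
exists ((u * u' - v * v' * z ^+ 2) / (u' ^+ 2 - v' ^+ 2 * z ^+ 2)).
exists ((v * u' - u * v') / (u' ^+ 2 - v' ^+ 2 * z ^+ 2)).
have vvz : v * v' * z ^+ 2 \in K by rewrite (rpredM (rpredM vK v'K) z2).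
split; first by rewrite rpred_div // rpredB ?(rpredM uK).
  by rewrite rpred_div // rpredB ?rpredM.
by rewrite eN; field; rewrite q0 q1.
Qed.

(** Let [z] be new at its level and [x = u + v * z]. Since [x ^+ 2] and [z ^+ 2] lie lower, so does
    [2 * u * v * z]; hence [u] or [v] is zero, and [x * z] or [x] respectively lies one level
    lower. *)
Lemma kummer (F : numFieldType) (M : divringClosed F) (s : seq F) (x : F) :
    {in s, forall z, z ^+ 2 \in M} -> x \in adjoins M s -> x ^+ 2 \in M ->
  exists m : bitseq, x * \prod_(z <- mask m s) z \in M.
Proof.
elim: s x => [|z s IH] x sM xs x2; first by exists [::]; rewrite big_nil mulr1.
have z2 : z ^+ 2 \in M by rewrite sM ?mem_head.
have {}IH y := IH y (fun w ws => sM w (mem_behead (s := z :: s) ws)).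
have MK := @adjoins_base _ M s.
have xK : x \in adjoins M s ->
    exists m : bitseq, x * \prod_(z <- mask m (z :: s)) z \in M.
  by move=> /IH/(_ x2)[m mM]; exists (false :: m).
have [zK|zK] := boolP (z \in adjoins M s).
  by apply: xK; apply: adjoin_min zK _ xs.
have [u [v [uK vK ex]]] := adjoin_quadraticP (MK _ z2) zK xs.
have [v0|v0] := eqVneq v 0; first by apply: xK; rewrite ex v0 mul0r addr0.
have [u0|u0] := eqVneq u 0; last first.
  case/negP: zK.
  have -> : z = (x ^+ 2 - u ^+ 2 - v ^+ 2 * z ^+ 2) / (2 * u * v).
    by rewrite ex; field; rewrite v0 u0.
  apply: rpred_div; last by rewrite rpredM // rpredM ?rpred_nat.
  apply: rpredB; last exact: rpredM (rpredX 2 vK) (MK _ z2).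
  exact: rpredB (MK _ x2) (rpredX 2 uK).
have [||m mM] := IH (x * z).
- by rewrite ex u0 add0r -mulrA (rpredM vK) ?MK.
- by rewrite exprMn (rpredM x2 z2).
by exists (true :: m); rewrite big_cons mulrA.
Qed.

(** * Heron's polynomial *)

(** The squared area of a triangle with squared sides [a], [b], [d]. It is symmetric in them, but is
    written as a quadratic in [a] with the square completed. *)
Definition heron (F : fieldType) (a b d : F) : F :=
  (4 * b * d - (a - b - d) ^+ 2) / 16.

Section HeronNonSquare.
Variables (F : numClosedFieldType) (K : divringClosed F) (a b : F).
Hypothesis (bK : b \notin algebraic_over K).
Hypothesis (aK : a \notin algebraic_over (adjoin K b)).

(** The zeros, [(sqrt b + sqrt d) ^ 2] and [(sqrt b - sqrt d) ^ 2], correspond to degenerate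
    triangles. *)
Definition heron_poly (d : F) : {poly F} :=
  (1 / 16)%:P * ((4 * b * d)%:P - ('X - (b + d)%:P) ^+ 2).

Lemma horner_heron x d : (heron_poly d).[x] = heron x b d.
Proof.
rewrite /heron_poly hornerM hornerD hornerN expr2 hornerM !hornerXsubC !hornerC.
by rewrite /heron; field.
Qed.

(* The zero [(sqrt b + sqrt d) ^ 2] of [heron x b d] is simple, and no
   [heron x b d'] with [d' != d] vanishes there. *)
Lemma heron_prod_not_square (d : F) (s : seq F) (y : F) :
    d \in K -> {subset s <= K} -> d != 0 -> d \notin s ->
    y \in adjoin (adjoin K b) a ->
  y ^+ 2 != heron a b d * \prod_(e <- s) heron a b e.
Proof.
move=> dK sK d0 ds /adjoinP[p [q [pN qN q0 ->]]]; apply/eqP => ey.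
rewrite unitfE in q0.
pose P := \prod_(e <- s) heron_poly e.
have eP : P.[a] = \prod_(e <- s) heron a b e.
  by rewrite horner_prod; apply: eq_bigr => e _; rewrite horner_heron.
have hN e : e \in K -> heron_poly e \is a polyOver (adjoin K b).
  move=> eK; have eN := adjoin_sub b eK; have bN := adjoin_gen K b.
  apply: rpredM; first by rewrite polyOverC rpred_div ?rpred1 ?rpred_nat.
  apply: rpredB; first by rewrite polyOverC rpredM ?rpredM ?rpred_nat.
  by apply: rpredX; rewrite polyOverXsubC rpredD.
(* As [a] is transcendental over [K(b)], the equation at [a] is an identity of polynomials. *)
have id : p ^+ 2 = q ^+ 2 * (heron_poly d * P).
  apply/eqP; rewrite -subr_eq0; apply: contraNT aK => nz.
  apply/algebraic_overP; exists (p ^+ 2 - q ^+ 2 * (heron_poly d * P)); split=> //.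
    apply: rpredB; first exact: rpredX.
    apply: rpredM; first exact: rpredX.
    apply: rpredM; first exact: hN.
    by rewrite /P big_seq; apply: rpred_prod => e es; rewrite hN ?sK.
  rewrite /root hornerD hornerN (hornerM (q ^+ 2)) (hornerM (heron_poly d)).
  by rewrite !horner_exp eP horner_heron -ey; apply/eqP; field.
pose B := sqrtC b; pose D := sqrtC d; pose r := (B + D) ^+ 2.
have B2 : B ^+ 2 = b by rewrite sqrtCK.
have D2 : D ^+ 2 = d by rewrite sqrtCK.
have b0 : b != 0 by apply: contraNneq bK => ->; rewrite rpred0.
have BD0 : B * D != 0 by rewrite mulf_neq0 // sqrtC_eq0.
have Pr : ~~ root P r.
  rewrite /root horner_prod prodf_seq_neq0; apply/allP => e es /=.
  rewrite horner_heron.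
  have -> : heron r b e = - (d - e) * (4 * b + 4 * (B * D) + (d - e)) / 16.
    by rewrite /heron /r -B2 -D2; field.
  have de : d - e != 0 by rewrite subr_eq0; apply: contraNneq ds => ->.
  rewrite !mulf_neq0 ?oppr_eq0 ?invr_eq0 ?pnatr_eq0 //.
  have eK := sK e es.
  apply: contraNneq bK => e0; apply/algebraic_overP.
  (* Squaring [4 * b + (d - e) = - 4 * B * D] removes the square roots and leaves this quadratic
     equation for [b] over [K]. *)
  pose Q : {poly F} :=
    16%:P * 'X^2 + (8 * (d - e) - 16 * d)%:P * 'X + ((d - e) ^+ 2)%:P.
  exists Q; split.
  - apply: rpredD; first apply: rpredD.
    + by apply: rpredM; [rewrite polyOverC rpred_nat|rewrite rpredX // polyOverX].
    + by rewrite rpredM ?polyOverX // polyOverC !(rpredB, rpredM, rpred_nat).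
    + by rewrite polyOverC rpredX ?rpredB.
  - apply/eqP => /polyP/(_ 2%N) /eqP; apply/negP.
    rewrite !coefD !coefCM coefXn coefX coefC coef0 /= mulr0 !addr0 mulr1.
    by rewrite pnatr_eq0.
  - have e1 : 4 * b + (d - e) = - 4 * (B * D).
      by apply/eqP; rewrite -subr_eq0 -e0; apply/eqP; ring.
    have e2 : (4 * b + (d - e)) ^+ 2 = 16 * b * d by rewrite e1 -B2 -D2; ring.
    rewrite /root !hornerD !hornerM !hornerC !hornerX; apply/eqP.
    by rewrite -(subrr (16 * b * d)) -{1}e2; ring.
have hd : heron_poly d = ('X - r%:P) * ((-1 / 16)%:P * ('X - ((B - D) ^+ 2)%:P)).
  rewrite /heron_poly /r -B2 -D2.
  by rewrite !(polyCM, polyCB, polyCD, polyC_exp, polyCN, polyC1); ring.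
move: (heron_poly d) id hd => h id hd.
have hr : ~~ root ((-1 / 16)%:P * ('X - ((B - D) ^+ 2)%:P)) r.
  rewrite rootM rootC root_XsubC negb_or.
  rewrite mulf_neq0 ?invr_eq0 ?oppr_eq0 ?oner_neq0 ?pnatr_eq0 //=.
  rewrite -subr_eq0; have -> : r - (B - D) ^+ 2 = 4 * (B * D) by rewrite /r; ring.
  by rewrite mulf_neq0 ?pnatr_eq0.
have nz (g : {poly F}) : ~~ root g r -> g != 0.
  by apply: contraNneq => ->; rewrite root0.
have hd0 : h != 0 by rewrite hd mulf_neq0 ?polyXsubC_eq0 ?nz.
have qn0 : q != 0 by apply: contraNneq q0 => ->; rewrite horner0.
have pn0 : p != 0.
  have : p ^+ 2 != 0.
    by rewrite id (mulf_neq0 (expf_neq0 2 qn0)) // (mulf_neq0 hd0) // nz.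
  by rewrite expf_eq0.
have sq (g : {poly F}) : g != 0 -> mup r (g ^+ 2) = (mup r g).*2.
  by move=> g0; rewrite expr2 mupM // addnn.
have mh : mup r h = 1%N.
  by rewrite hd mupMl // -['X - _]expr1 mup_XsubCX eqxx.
(* The multiplicity of [r] is even on the left and odd on the right. *)
move/(congr1 (fun g => odd (mup r g))): id.
rewrite mulrA (mupMl _ Pr) (mupM _ (expf_neq0 2 qn0)) // !sq // mh oddD.
by rewrite !odd_double.
Qed.
End HeronNonSquare.

(** * Realizations *)

Section SubfieldGen.
Variable F : numFieldType.
Implicit Types S : set F.

Lemma subfield_gen_incl S x : S x -> subfield_gen S x.
Proof. by move=> Sx K _; apply. Qed.

Lemma subfield_gen_subfield S : subfield (subfield_gen S).
Proof.
have mem x : (x \in subfield_gen S) = `[< subfield_gen S x >] by [].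
split=> [|x y|x y]; rewrite !mem.
- by apply/asboolP => K [K1 _ _] _; rewrite inE in K1.
- move=> /asboolP Sx /asboolP Sy; apply/asboolP => K KS SK; case: (KS) => _ KB _.
  by have := KB x y; rewrite !inE; apply; [apply: Sx|apply: Sy].
- move=> /asboolP Sx /asboolP Sy; apply/asboolP => K KS SK; case: (KS) => _ _ KD.
  by have := KD x y; rewrite !inE; apply; [apply: Sx|apply: Sy].
Qed.

Lemma subfield_gen_min S (K : divringClosed F) :
  (forall x, S x -> x \in K) -> forall x, subfield_gen S x -> x \in K.
Proof.
by move=> SK x /(_ [set` K]%classic); apply=> //; exact: closed_subfield.
Qed.

End SubfieldGen.

(** * A triangle recovered from two vertices, two squared sides and its area *)

Section Apex.
Variable F : numFieldType.
Implicit Types p : point F.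

Lemma sqdistC p p' : sqdist p p' = sqdist p' p.
Proof. by rewrite /sqdist; ring. Qed.

Lemma signed_area_sqr p1 p2 p3 : signed_area p1 p2 p3 ^+ 2 =
  heron (sqdist p3 p1) (sqdist p3 p2) (sqdist p1 p2).
Proof. by rewrite /signed_area /heron /sqdist; field. Qed.

(** Solves for [p3 - p1]: its scalar product with [w = p2 - p1] is [(a + d - b) / 2] by the law of
    cosines, and its cross product with [w] is [2 * A]. The determinant of this linear system is [d]
    up to sign. *)
Definition apex p1 p2 (a b A : F) : point F :=
  let d := sqdist p1 p2 in
  let w1 := p2.1 - p1.1 in let w2 := p2.2 - p1.2 in
  (p1.1 + ((a + d - b) / 2 * w1 + 2 * A * w2) / d,
   p1.2 + ((a + d - b) / 2 * w2 - 2 * A * w1) / d).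

Lemma apexE p1 p2 p3 : sqdist p1 p2 != 0 ->
  p3 = apex p1 p2 (sqdist p3 p1) (sqdist p3 p2) (signed_area p1 p2 p3).
Proof.
case: p1 p2 p3 => [x1 y1] [x2 y2] [x3 y3] d0; rewrite /apex /=.
have e x y z : z * sqdist (x1, y1) (x2, y2) = y ->
    x + y / sqdist (x1, y1) (x2, y2) = x + z.
  by move=> <-; rewrite mulfK.
congr pair.
  apply: etrans (esym (e _ _ (x3 - x1) _)); first by ring.
  by rewrite /sqdist /signed_area /=; field.
apply: etrans (esym (e _ _ (y3 - y1) _)); first by ring.
by rewrite /sqdist /signed_area /=; field.
Qed.

Lemma apexP p1 p2 (a b A : F) : sqdist p1 p2 != 0 ->
    A ^+ 2 = heron a b (sqdist p1 p2) ->
  [/\ sqdist (apex p1 p2 a b A) p1 = a, sqdist (apex p1 p2 a b A) p2 = b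
    & signed_area p1 p2 (apex p1 p2 a b A) = A].
Proof.
move=> d0 eA; rewrite /apex; set d := sqdist p1 p2 in d0 eA *.
set w1 := p2.1 - p1.1; set w2 := p2.2 - p1.2.
have ed : d = w1 ^+ 2 + w2 ^+ 2 by rewrite /d /sqdist /w1 /w2; ring.
have e1 : p2.1 = p1.1 + w1 by rewrite /w1; ring.
have e2 : p2.2 = p1.2 + w2 by rewrite /w2; ring.
(* Heron's formula as Lagrange's identity: cross product squared plus scalar product squared is
   [a * d]. *)
have eA4 : 4 * A ^+ 2 = a * d - ((a + d - b) / 2) ^+ 2.
  by rewrite eA /heron; field.
clearbody d w1 w2; rewrite /sqdist /signed_area /= e1 e2.
have E1 : (((a + d - b) / 2 * w1 + 2 * A * w2) / d) ^+ 2
   + (((a + d - b) / 2 * w2 - 2 * A * w1) / d) ^+ 2 = a.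
  have -> : (((a + d - b) / 2 * w1 + 2 * A * w2) / d) ^+ 2
    + (((a + d - b) / 2 * w2 - 2 * A * w1) / d) ^+ 2 =
    (((a + d - b) / 2) ^+ 2 + 4 * A ^+ 2) * (w1 ^+ 2 + w2 ^+ 2) / d ^+ 2 by field.
  by rewrite -ed eA4; field.
have E2 : ((a + d - b) / 2 * w1 + 2 * A * w2) / d * w1 +
   ((a + d - b) / 2 * w2 - 2 * A * w1) / d * w2 = (a + d - b) / 2.
  have -> : ((a + d - b) / 2 * w1 + 2 * A * w2) / d * w1 +
   ((a + d - b) / 2 * w2 - 2 * A * w1) / d * w2 =
   (a + d - b) / 2 * (w1 ^+ 2 + w2 ^+ 2) / d by field.
  by rewrite -ed; field.
have E3 : ((a + d - b) / 2 * w1 + 2 * A * w2) / d * w2 -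
   ((a + d - b) / 2 * w2 - 2 * A * w1) / d * w1 = 2 * A.
  have -> : ((a + d - b) / 2 * w1 + 2 * A * w2) / d * w2 -
   ((a + d - b) / 2 * w2 - 2 * A * w1) / d * w1 =
   2 * A * (w1 ^+ 2 + w2 ^+ 2) / d by field.
  by rewrite -ed; field.
move: E1 E2 E3; set q1 := _ / d; set q2 := _ / d => E1 E2 E3.
clearbody q1 q2; split.
- by rewrite -[RHS]E1; ring.
- have -> : (p1.1 + q1 - (p1.1 + w1)) ^+ 2 + (p1.2 + q2 - (p1.2 + w2)) ^+ 2 =
    (q1 ^+ 2 + q2 ^+ 2) - 2 * (q1 * w1 + q2 * w2) + (w1 ^+ 2 + w2 ^+ 2) by ring.
  by rewrite E1 E2 -ed; field.
- have -> : 2^-1 * ((p1.1 + w1 - (p1.1 + q1)) * (p1.2 - (p1.2 + q2)) -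
    (p1.1 - (p1.1 + q1)) * (p1.2 + w2 - (p1.2 + q2))) = (q1 * w2 - q2 * w1) / 2.
    by field.
  by rewrite E3; field.
Qed.

End Apex.

Lemma algebraic_over_sqr (F : fieldType) (K : divringClosed F) x :
  x ^+ 2 \in algebraic_over K -> x \in algebraic_over K.
Proof.
move=> x2; apply: algebraic_over_idem; apply/algebraic_overP.
exists ('X^2 - (x ^+ 2)%:P); split.
- by rewrite rpredB ?polyOverXn ?polyOverC.
- by rewrite -size_poly_eq0 size_XnsubC.
- by rewrite /root !hornerE subrr.
Qed.

(** * Labels against free coordinates *)

Section Rigidity.
Variables (F : numFieldType) (V : finType) (E : {set {set V}}) (v1 v2 : V).
Variable lambda : {set V} -> F.
Hypotheses (E_simple : simple_graph E) (v1v2E : [set v1; v2]%SET \in E).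
Hypothesis card_E : (#|E| + 3 = 2 * #|V|)%N.

Definition labels : seq F := [seq lambda e | e <- enum (other_edges E v1 v2)].

Hypothesis labels_free : alg_free (@rationals F) labels.
Variable rho : realizations E v1 v2 lambda.

Lemma realization_v1 : val rho v1 = (0, 0).
Proof. by case: rho => r /= /andP[_ /andP[/eqP]]. Qed.

Lemma realization_v2 : val rho v2 = (1, 0).
Proof. by case: rho => r /= /andP[_ /andP[_ /eqP]]. Qed.

Lemma realization_edge u v : [set u; v]%SET \in E ->
  lambda [set u; v]%SET = sqdist (val rho u) (val rho v).
Proof.
case: rho => r /= /andP[/forallP/(_ u)/forallP/(_ v)/implyP c _] uvE.
exact/eqP/c.
Qed.

Lemma realization_labels_span (s : seq F) :
    (forall v, v \notin [set v1; v2]%SET ->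
       (val rho v).1 \in s /\ (val rho v).2 \in s) ->
  {subset labels <= alg_span (@rationals F) s}.
Proof.
move=> sv; have span v :
    ((val rho v).1 \in alg_span (@rationals F) s) /\
    ((val rho v).2 \in alg_span (@rationals F) s).
  have [|/sv[? ?]] := boolP (v \in [set v1; v2]%SET); last first.
    by split; apply: alg_span_mem.
  by case/set2P=> ->; rewrite ?realization_v1 ?realization_v2 /=;
     rewrite ?rpred0 ?rpred1.
move=> _ /mapP[e + ->]; rewrite mem_enum => /setD1P[_ eE].
have /eqP/cards2P[u [v [_ euv]]] := E_simple eE; rewrite euv in eE *.
have [[xu yu] [xv yv]] := (span u, span v).
by rewrite realization_edge // rpredD // rpredX // rpredB.
Qed.

(** Removing the fixed edge leaves [2 |V| - 4] labels, and fixing two vertices leaves as many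
    coordinates. *)
Lemma size_labels : (size labels = 2 * #|~: [set v1; v2]%SET|)%N.
Proof.
rewrite size_map -cardE.
have arith (e v c o : nat) :
  (e + 3 = 2 * v -> 2 + c = v -> e = 1 + o -> o = 2 * c)%N by lia.
apply: arith card_E _ _; first by rewrite -(E_simple v1v2E) cardsC.
by rewrite (cardsD1 [set v1; v2]%SET E) v1v2E.
Qed.

Lemma realization_algebraic v :
  ((val rho v).1 \in alg_span (@rationals F) labels) &&
  ((val rho v).2 \in alg_span (@rationals F) labels).
Proof.
pose vs := enum (~: [set v1; v2]%SET).
pose s := [seq (val rho v).1 | v <- vs] ++ [seq (val rho v).2 | v <- vs].
have vss v' : v' \notin [set v1; v2]%SET ->
     (val rho v').1 \in s /\ (val rho v').2 \in s.
  move=> v'n; rewrite !mem_cat; split; apply/orP; [left|right];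
    by apply/mapP; exists v' => //; rewrite mem_enum inE.
have := alg_free_span labels_free (realization_labels_span vss).
rewrite size_labels size_cat !size_map -cardE mulSn mul1n => /(_ erefl) span.
have [|/vss[/span-> /span->]//] := boolP (v \in [set v1; v2]%SET).
by case/set2P=> ->; rewrite ?realization_v1 ?realization_v2 /=;
   rewrite ?rpred0 ?rpred1.
Qed.

(** If the squared distance were zero, the abscissa of [i] would be algebraic over the other free
    coordinates, and these are too few to span the labels. *)
Lemma realization_sqdist_neq0 i j : i != j ->
  sqdist (val rho i) (val rho j) != 0.
Proof.
wlog iv : i j / i \notin [set v1; v2]%SET => [wlg ij|].
  have [iv|] := boolP (i \in [set v1; v2]%SET); last by move=> ?; apply: wlg.
  have [jv|jv] := boolP (j \in [set v1; v2]%SET); last first.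
    by rewrite sqdistC wlg // eq_sym.
  move: iv jv ij; case/set2P=> -> /set2P[]->; rewrite ?eqxx // => _;
    rewrite ?realization_v1 ?realization_v2 /sqdist /=;
    by rewrite !(subr0, sub0r, sqrrN, expr0n, addr0, expr1n) oner_neq0.
move=> ij.
pose vs := enum (~: [set v1; v2]%SET).
(* All free coordinates but the abscissa of [i]: one fewer than there are labels. *)
pose s := [seq (val rho v).1 | v <- rem i vs] ++ [seq (val rho v).2 | v <- vs].
have ivs : i \in vs by rewrite mem_enum inE.
have vs2 v : v \notin [set v1; v2]%SET -> (val rho v).2 \in s.
  move=> vn; rewrite mem_cat; apply/orP; right.
  by apply/mapP; exists v => //; rewrite mem_enum inE.
have vs1 v : v \notin [set v1; v2]%SET -> v != i -> (val rho v).1 \in s.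
  move=> vn vi; rewrite mem_cat; apply/orP; left; apply/mapP; exists v => //.
  by rewrite mem_rem_uniq ?enum_uniq // inE vi mem_enum inE.
have : (val rho i).1 \notin alg_span (@rationals F) s.
  apply: alg_span_redundant labels_free _ _.
    apply: realization_labels_span => v vn.
    split; last by rewrite in_cons vs2 ?orbT.
    by rewrite in_cons; case: (eqVneq v i) => [->|vi];
      [rewrite eqxx|rewrite vs1 ?orbT].
  rewrite size_labels size_cat !size_map size_rem // -cardE.
  have : (0 < #|~: [set v1; v2]%SET|)%N by apply/card_gt0P; exists i; rewrite inE.
  by lia.
apply: contraNneq => d0.
have sp v : (v != i -> (val rho v).1 \in alg_span (@rationals F) s) /\
    (val rho v).2 \in alg_span (@rationals F) s.
  have [|vn] := boolP (v \in [set v1; v2]%SET); last first.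
    by split=> [vi|]; apply: alg_span_mem; [apply: vs1|apply: vs2].
  by case/set2P=> ->; rewrite ?realization_v1 ?realization_v2 /=;
     rewrite ?rpred0 ?rpred1.
have [xj yj] := sp j; have [_ yi] := sp i; rewrite eq_sym ij in xj.
rewrite -[(val rho i).1](subrK (val rho j).1) rpredD ?xj //.
apply: algebraic_over_sqr; move/eqP: d0; rewrite addr_eq0 => /eqP->.
by rewrite rpredN rpredX // rpredB.
Qed.

End Rigidity.

(** * Transport along the graph of an isomorphism *)

Section CoherentOps.
Variables (F : numFieldType) (G : divringClosed (F * F)%type).
Hypothesis cG : coherent G.

Lemma coherent_fun x y y' : (x, y) \in G -> (x, y') \in G -> y = y'.
Proof.
move=> xy xy'; have := cG (rpredB xy xy').
by rewrite /= subrr eqxx => /esym; rewrite subr_eq0 => /eqP.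
Qed.

Lemma coherent_inj x x' y : (x, y) \in G -> (x', y) \in G -> x = x'.
Proof.
move=> xy xy'; have := cG (rpredB xy xy').
by rewrite /= subrr eqxx subr_eq0 => /eqP.
Qed.

(** The inverse in [F * F] is componentwise on units only; coherence makes every nonzero pair of [G]
    a unit. *)
Lemma coherentV x y : (x, y) \in G -> (x^-1, y^-1) \in G.
Proof.
move=> xy; have e : (x == 0) = (y == 0) := cG xy.
have [x0|x0] := eqVneq x 0.
  by move: e; rewrite x0 eqxx => /esym/eqP ->; rewrite invr0 (rpred0 G).
have y0 : y != 0 by rewrite -e.
have u : (x, y) \is a GRing.unit by rewrite pair_unitE /= x0.
suff -> : (x^-1, y^-1) = (x, y)^-1 by rewrite rpredV.
by apply: (mulrI u); rewrite divrr //; congr pair; rewrite /= mulfV.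
Qed.

Lemma coherent_div x y x' y' :
  (x, y) \in G -> (x', y') \in G -> (x / x', y / y') \in G.
Proof. by move=> xy /coherentV x'y'; exact: (rpredM xy x'y'). Qed.

Definition related (p p' : point F) :=
  ((p.1, p'.1) \in G) && ((p.2, p'.2) \in G).

Lemma related_sqdist p p' q q' : related p p' -> related q q' ->
  (sqdist p q, sqdist p' q') \in G.
Proof.
move=> /andP[p1 p2] /andP[q1 q2].
exact: rpredD (rpredX 2 (rpredB p1 q1)) (rpredX 2 (rpredB p2 q2)).
Qed.

Lemma related_area p p' q q' r r' : related p p' -> related q q' ->
  related r r' -> (signed_area p q r, signed_area p' q' r') \in G.
Proof.
move=> /andP[p1 p2] /andP[q1 q2] /andP[r1 r2].
exact: (rpredM (coherentV (rpred_nat G 2)) (rpredB (rpredM (rpredB q1 r1)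
  (rpredB p2 r2)) (rpredM (rpredB p1 r1) (rpredB q2 r2)))).
Qed.

Lemma related_heron a a' b b' d d' : (a, a') \in G -> (b, b') \in G ->
  (d, d') \in G -> (heron a b d, heron a' b' d') \in G.
Proof.
move=> aG bG dG; apply: coherent_div (rpred_nat G 16).
exact: (rpredB (rpredM (rpredM (rpred_nat G 4) bG) dG)
  (rpredX 2 (rpredB (rpredB aG bG) dG))).
Qed.

Lemma related_apex p p' q q' a a' b b' A A' : related p p' -> related q q' ->
    (a, a') \in G -> (b, b') \in G -> (A, A') \in G ->
  related (apex p q a b A) (apex p' q' a' b' A').
Proof.
move=> pp qq aG bG AG; have dG := related_sqdist pp qq.
have two := rpred_nat G 2.
move: pp qq => /andP[p1 p2] /andP[q1 q2].
have w1 := rpredB q1 p1; have w2 := rpredB q2 p2.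
have m := coherent_div (rpredB (rpredD aG dG) bG) two.
apply/andP; split.
  exact: rpredD p1 (coherent_div (rpredD (rpredM m w1)
     (rpredM (rpredM two AG) w2)) dG).
exact: rpredD p2 (coherent_div (rpredB (rpredM m w2)
   (rpredM (rpredM two AG) w1)) dG).
Qed.

(** The inverse image of [M] under the isomorphism with graph [G]. *)
Definition image_pred (M : divringClosed F) : {pred F} :=
  fun x => `[< exists2 y, y \in M & (x, y) \in G >].

Fact image_pred_divring M : divring_closed (image_pred M).
Proof.
split=> [|x y|x y].
- by apply/asboolP; exists 1; [exact: rpred1|exact: (rpred1 G)].
- move=> /asboolP[x' xM xG] /asboolP[y' yM yG]; apply/asboolP.
  by exists (x' - y'); [exact: rpredB|exact: (rpredB xG yG)].
- move=> /asboolP[x' xM xG] /asboolP[y' yM yG]; apply/asboolP.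
  by exists (x' / y'); [exact: rpred_div|exact: coherent_div].
Qed.

(** Reduces to generators the claim that one field is mapped into another; applied to the swapped
    graph it yields surjectivity. *)
Lemma coherent_gen (S T : set F) :
    (forall x, S x -> exists2 y, subfield_gen T y & (x, y) \in G) ->
  forall x, subfield_gen S x -> exists2 y, subfield_gen T y & (x, y) \in G.
Proof.
move=> SG x; pose M := subfield_closed (subfield_gen_subfield T).
pose P : divringClosed F := HB.pack (image_pred M)
  (GRing.isDivringClosed.Build F (image_pred M) (image_pred_divring M)).
move=> /(@subfield_gen_min _ _ P) /=.
case/(_ _)/asboolP => [z /SG[y Ty zG]|y].
  by apply/asboolP; exists y => //; rewrite inE.
by rewrite inE; exists y.
Qed.

Definition diagonal_pred : {pred F} := fun x => (x, x) \in G.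

Fact diagonal_pred_divring : divring_closed diagonal_pred.
Proof.
split=> [|x y xG yG|x y xG yG]; first exact: (rpred1 G).
  exact: (rpredB xG yG).
exact: coherent_div.
Qed.

Lemma coherent_diagonal (S : set F) : (forall x, S x -> (x, x) \in G) ->
  forall x, subfield_gen S x -> (x, x) \in G.
Proof.
move=> SG x; pose P : divringClosed F := HB.pack diagonal_pred
  (GRing.isDivringClosed.Build F diagonal_pred diagonal_pred_divring).
by move=> /(@subfield_gen_min _ _ P) /=; apply.
Qed.

Definition swap_pred : {pred F * F} := fun u => (u.2, u.1) \in G.

Fact swap_pred_divring : divring_closed swap_pred.
Proof.
split=> [|x y xG yG|x y xG yG]; first exact: (rpred1 G).
  exact: (rpredB xG yG).
have [uy|uy] := boolP (y \is a GRing.unit); last first.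
  by rewrite invr_out //; exact: (rpredM xG yG).
have -> : x / y = (x.1 / y.1, x.2 / y.2).
  apply: (mulIr uy); rewrite divrK //; move: uy; rewrite pair_unitE.
  by case: x {xG} => x1 x2 /andP[y1 y2]; congr pair; rewrite /= divfK.
exact: coherent_div.
Qed.
HB.instance Definition _ :=
  GRing.isDivringClosed.Build (F * F)%type swap_pred swap_pred_divring.

Lemma coherent_swap : coherent swap_pred.
Proof. by move=> u /cG /= ->. Qed.

Lemma coherent_Galois (L K : set F) :
    (forall x, L x -> exists2 y, L y & (x, y) \in G) ->
    (forall y, L y -> exists2 x, L x & (x, y) \in G) ->
    (forall x, K x -> L x /\ (x, x) \in G) -> subfield L ->
  exists2 s, Galois_group L K s & forall x, L x -> (x, s x) \in G.
Proof.
move=> Ldom Lran KG LS.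
have LD x y : L x -> L y -> L (x + y).
  by have := @rpredD _ (subfield_closed LS) x y; rewrite !mem_subfield_closed !inE.
have LM x y : L x -> L y -> L (x * y).
  by have := @rpredM _ (subfield_closed LS) x y; rewrite !mem_subfield_closed !inE.
(* Outside [L] the value is the default 0; only the values on [L] count. *)
pose s x := xget 0 [set y | L y /\ (x, y) \in G]%classic.
have sP x : L x -> L (s x) /\ (x, s x) \in G.
  by case/Ldom => y Ly xy; rewrite /s; case: xgetP => [z -> //|/(_ y)[]].
exists s; last by move=> x /sP[].
split.
- split=> [x /sP[]//|x y|y /Lran[x Lx xy]].
    rewrite !inE => /sP[_ xG] /sP[_ yG] e; rewrite e in xG.
    exact: coherent_inj xG yG.
  exists x => //; have [_ xG] := sP x Lx; exact: coherent_fun xG xy.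
- move=> x y; rewrite !inE => Lx Ly; have [_ xyG] := sP _ (LD _ _ Lx Ly).
  exact: coherent_fun xyG (rpredD (sP x Lx).2 (sP y Ly).2).
- move=> x y; rewrite !inE => Lx Ly; have [_ xyG] := sP _ (LM _ _ Lx Ly).
  exact: coherent_fun xyG (rpredM (sP x Lx).2 (sP y Ly).2).
- move=> x; rewrite inE => /KG[Lx xG]; have [_ xsG] := sP x Lx.
  exact: coherent_fun xsG xG.
Qed.

End CoherentOps.

Lemma Galois_graph (F : numFieldType) (L K : set F) (s : F -> F) :
    subfield L -> Galois_group L K s ->
  exists2 G : divringClosed (F * F)%type, coherent G &
    (forall x, L x -> (x, s x) \in G) /\
    (forall x y, (x, y) \in G -> L x /\ y = s x).
Proof.
move=> LS [[sL sinj ssurj] sD sM sK]; pose M := subfield_closed LS.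
have ML x : (x \in M) = (x \in L) by [].
pose P : {pred F * F} := fun u => (u.1 \in L) && (u.2 == s u.1).
have PE u : (u \in P) = (u.1 \in L) && (u.2 == s u.1) by [].
have L0 : 0 \in L by rewrite -ML rpred0.
have L1 : 1 \in L by rewrite -ML rpred1.
have s0 : s 0 = 0 by apply: (addrI (s 0)); rewrite -sD // !addr0.
have s_eq0 x : x \in L -> (s x == 0) = (x == 0).
  move=> xL; apply/eqP/eqP => [sx|->//].
  by apply: sinj => //; rewrite s0.
have s1 : s 1 = 1.
  have n0 : s 1 != 0 by rewrite s_eq0 ?oner_neq0.
  by apply: (mulfI n0); rewrite -sM // !mulr1.
have sN x : x \in L -> s (- x) = - s x.
  move=> xL; have NxL : - x \in L by rewrite -ML rpredN.
  by apply/eqP; rewrite -addr_eq0 -sD // addNr s0.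
have sV x : x \in L -> s x^-1 = (s x)^-1.
  move=> xL; have VxL : x^-1 \in L by rewrite -ML rpredV.
  have [->|x0] := eqVneq x 0; first by rewrite s0 invr0 s0.
  have sx0 : s x != 0 by rewrite s_eq0.
  by apply: (mulfI sx0); rewrite -sM // mulfV ?mulfV.
have Pd : divring_closed P.
  split=> [|u v|u v]; rewrite !PE /= ?L1 ?s1 ?eqxx //.
  - move=> /andP[uL /eqP us] /andP[vL /eqP vs].
    have NvL : - v.1 \in L by rewrite -ML rpredN.
    by rewrite sD // sN // us vs eqxx andbT -ML rpredB.
  - move=> /andP[uL /eqP us] /andP[vL /eqP vs].
    have VvL : v.1^-1 \in L by rewrite -ML rpredV.
    have [uv|uv] := boolP (v \is a GRing.unit); last first.
      by rewrite invr_out // sM // us vs eqxx andbT -ML rpredM.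
    suff -> : v^-1 = (v.1^-1, v.2^-1).
      by rewrite /= sM // sV // us vs eqxx andbT -ML rpredM ?rpredV.
    apply: (mulrI uv); rewrite divrr //; move: uv; rewrite pair_unitE.
    by move=> /andP[v10 v20]; congr pair; rewrite /= mulfV.
pose G : divringClosed (F * F)%type :=
  HB.pack P (GRing.isDivringClosed.Build _ P Pd).
exists G.
  by move=> u; rewrite [_ \in _]PE => /andP[uL /eqP->]; rewrite s_eq0.
split=> [x Lx|x y]; rewrite [_ \in _]PE /=.
  by rewrite eqxx andbT inE.
by move=> /andP[/set_mem Lx /eqP].
Qed.

(** * The Galois action *)

Section GaloisAction.
Variables (F : numFieldType) (V : finType) (E : {set {set V}}) (v1 v2 : V).
Variable lambda : {set V} -> F.
Hypothesis lambda1 : lambda [set v1; v2]%SET = 1.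

Local Notation RG := (realizations E v1 v2 lambda).
Local Notation K := (base_field E v1 v2 lambda).
Local Notation L := (coordinate_field E v1 v2 lambda).

Lemma coordinate_field_subfield : subfield L.
Proof. exact: subfield_gen_subfield. Qed.

Lemma base_field_sub x : K x -> L x.
Proof. by move=> Kx; apply: subfield_gen_incl; left. Qed.

Lemma coordinate_fieldP (rho : RG) v : L (val rho v).1 /\ L (val rho v).2.
Proof.
by split; apply: subfield_gen_incl; right; exists rho, v; [left|right].
Qed.

Lemma base_field_label e : e \in other_edges E v1 v2 -> K (lambda e).
Proof. by move=> eE; apply: subfield_gen_incl; exists e. Qed.

(** Coordinates of [rho] are paired with those of [h rho]; since [h] is bijective, every generator
    of the field occurs on both sides. *)
Lemma coherent_coordinate_field (G : divringClosed (F * F)%type) (h : RG -> RG) :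
    coherent G -> bijective h -> (forall x, K x -> (x, x) \in G) ->
    (forall (rho : RG) v, related G (val rho v) (val (h rho) v)) ->
  (forall x, L x -> exists2 y, L y & (x, y) \in G) /\
  (forall y, L y -> exists2 x, L x & (x, y) \in G).
Proof.
move=> cG [h' hK h'K] fixed rel; split.
  apply: coherent_gen => // x [Kx|[rho [v xv]]].
    by exists x; [exact: base_field_sub|exact: fixed].
  have [? ?] := coordinate_fieldP (h rho) v; have /andP[? ?] := rel rho v.
  by case: xv => ->; [exists (val (h rho) v).1|exists (val (h rho) v).2].
apply: (@coherent_gen _ _ (@coherent_swap _ _ cG)) => y [Ky|[rho [v yv]]].
  by exists y; [exact: base_field_sub|exact: fixed].
have [? ?] := coordinate_fieldP (h' rho) v; have /andP[] := rel (h' rho) v.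
by rewrite h'K => ? ?; case: yv => ->;
  [exists (val (h' rho) v).1|exists (val (h' rho) v).2].
Qed.

Lemma acts_as_inj s (h h' : RG -> RG) : acts_as s h -> acts_as s h' -> h = h'.
Proof.
move=> sh sh'; apply/funext => rho; apply/val_inj/ffunP => v.
by rewrite sh sh'.
Qed.

Lemma Gal_acts s : Gal E v1 v2 lambda s -> exists h : RG -> RG, acts_as s h.
Proof.
move=> sG; have [G cG [sLG GsL]] :=
  Galois_graph coordinate_field_subfield sG.
have fixed x : K x -> (x, x) \in G.
  move=> Kx; have [_ _ _ sK] := sG.
  by have := sLG x (base_field_sub Kx); rewrite sK ?inE.
suff /choice[h hP] : forall rho : RG, exists rho' : RG,
    forall v, val rho' v = map_point s (val rho v) by exists h.
move=> rho; pose r := [ffun v => map_point s (val rho v)].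
have rel v : related G (val rho v) (r v).
  by rewrite ffunE /related; have [Lx Ly] := coordinate_fieldP rho v; rewrite !sLG.
have r_ok : compatible E lambda r && normalized v1 v2 r.
  apply/andP; split.
    apply/forallP => u; apply/forallP => v; apply/implyP => uvE; apply/eqP.
    have dG := related_sqdist (rel u) (rel v).
    rewrite -(realization_edge rho uvE) in dG.
    apply: (coherent_fun cG) dG.
    (* The label of the fixed edge is not among the generators of the base field, but it is 1. *)
    have [e|ne] := eqVneq [set u; v]%SET [set v1; v2]%SET.
      by rewrite e lambda1; exact: (rpred1 G).
    by apply: fixed; apply: base_field_label; apply/setD1P.
  have := rel v1; have := rel v2.
  rewrite realization_v1 realization_v2 /related /=.
  move=> /andP[/(coherent_fun cG (rpred1 G)) e1 /(coherent_fun cG (rpred0 G)) e2].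
  move=> /andP[/(coherent_fun cG (rpred0 G)) e3 /(coherent_fun cG (rpred0 G)) e4].
  apply/andP; split; apply/eqP.
    by rewrite [r v1]surjective_pairing -e3 -e4.
  by rewrite [r v2]surjective_pairing -e1 -e2.
exists (Sub r r_ok) => v; by rewrite SubK ffunE.
Qed.

Lemma Gal_comp s t : Gal E v1 v2 lambda s -> Gal E v1 v2 lambda t ->
  Gal E v1 v2 lambda (s \o t).
Proof.
move=> [sb sD sM sK] [tb tD tM tK]; have [tL _ _] := tb.
have tL' x : x \in L -> t x \in L by rewrite !inE; exact: tL.
split; first exact: set_bij_comp tb sb.
- by move=> x y xL yL /=; rewrite tD // sD // tL'.
- by move=> x y xL yL /=; rewrite tM // sM // tL'.
- by move=> x xK; rewrite /= tK // sK.
Qed.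

(** The elements with a common image under [s] and [t] form a subfield, and it contains the base
    field and all coordinates. *)
Lemma Gal_faithful s t (h : RG -> RG) : Gal E v1 v2 lambda s ->
  Gal E v1 v2 lambda t -> acts_as s h -> acts_as t h -> {in L, s =1 t}.
Proof.
move=> sG tG sh th.
have [G cG [sLG GsL]] :=
  Galois_graph coordinate_field_subfield sG.
have [H cH [tLH HtL]] :=
  Galois_graph coordinate_field_subfield tG.
pose P : {pred F} := fun x => `[< exists y, (x, y) \in G /\ (x, y) \in H >].
have Pd : divring_closed P.
  split.
  - by apply/asboolP; exists 1; split; [exact: (rpred1 G)|exact: (rpred1 H)].
  - move=> x y /asboolP[x' [xG xH]] /asboolP[y' [yG yH]]; apply/asboolP.
    by exists (x' - y'); split; [exact: (rpredB xG yG)|exact: (rpredB xH yH)].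
  - move=> x y /asboolP[x' [xG xH]] /asboolP[y' [yG yH]]; apply/asboolP.
    by exists (x' / y'); split;
      [exact: coherent_div xG yG|exact: coherent_div xH yH].
pose PK : divringClosed F := HB.pack P (GRing.isDivringClosed.Build F P Pd).
have [_ _ _ sK] := sG; have [_ _ _ tK] := tG.
move=> x; rewrite inE => /(@subfield_gen_min _ _ PK)/=.
case/(_ _)/asboolP => [{}x|y [/GsL[_ <-] /HtL[_ <-]]//].
move=> [Kx|[rho [v xv]]]; apply/asboolP.
  exists x; have := sLG _ (base_field_sub Kx); have := tLH _ (base_field_sub Kx).
  by rewrite sK ?tK ?inE.
have [L1 L2] := coordinate_fieldP rho v.
have := th rho v; rewrite sh => -[e1 e2].
by case: xv => ->; [exists (s (val rho v).1)|exists (s (val rho v).2)];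
  rewrite sLG //; rewrite ?e1 ?e2 tLH.
Qed.

Lemma Gal_inverse s : Gal E v1 v2 lambda s -> exists2 t, Gal E v1 v2 lambda t &
  {in L, cancel s t} /\ {in L, cancel t s}.
Proof.
move=> sG; have [G cG [sLG GsL]] :=
  Galois_graph coordinate_field_subfield sG.
have [[sL _ ssurj] _ _ sK] := sG.
have [||||t tG tP] := @coherent_Galois _ _ (@coherent_swap _ _ cG) L K.
- by move=> x /ssurj[y Ly <-]; exists y => //; exact: sLG.
- by move=> x Lx; exists (s x); [exact: sL|exact: sLG].
- move=> x Kx; have Lx := base_field_sub Kx; split=> //.
  by have := sLG x Lx; rewrite sK ?inE.
- exact: coordinate_field_subfield.
exists t => //; split=> x; rewrite inE => Lx.
  have := tP _ (sL _ Lx) => /(coherent_inj cG); apply; exact: sLG.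
by have /GsL[_ <-] : (t x, x) \in G := tP x Lx.
Qed.

End GaloisAction.

(** * The Henneberg step *)

Section Henneberg.
Variables (F : numClosedFieldType) (V : finType) (E : {set {set V}}).
Variables (v1 v2 i j : V) (lambda : {set option V} -> F).
Hypotheses (E_simple : simple_graph E) (card_E : (#|E| + 3 = 2 * #|V|)%N).
Hypotheses (v1v2E : [set v1; v2]%SET \in E) (ij : i != j).

Local Notation EG := (henneberg1 E i j).
Local Notation lambda' := (restrict_labelling lambda).
Local Notation RG := (realizations EG (Some v1) (Some v2) lambda).
Local Notation RG' := (realizations E v1 v2 lambda').
Local Notation a := (lambda [set None; Some i]%SET).
Local Notation b := (lambda [set None; Some j]%SET).
Local Notation L := (coordinate_field EG (Some v1) (Some v2) lambda).
Local Notation K := (base_field EG (Some v1) (Some v2) lambda).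
Local Notation L' := (coordinate_field E v1 v2 lambda').
Local Notation K' := (base_field E v1 v2 lambda').

Hypothesis lambda_generic : generic_labelling EG (Some v1) (Some v2) lambda.

Lemma Some_set2 (x y : V) : (Some @: [set x; y] = [set Some x; Some y])%SET.
Proof. by rewrite imsetU !imset_set1. Qed.

Lemma Some_imset_inj : injective (fun e : {set V} => (Some @: e)%SET).
Proof. by apply: imset_inj => x y []. Qed.

Lemma None_notin_Some (e : {set V}) : None \notin (Some @: e)%SET.
Proof. by apply/imsetP => -[]. Qed.

Lemma henneberg_Some e : e \in E -> (Some @: e)%SET \in EG.
Proof.
by move=> eE; rewrite finset.in_setU; apply/orP; left; apply/imsetP; exists e.
Qed.

Lemma henneberg_i : [set None; Some i]%SET \in EG.
Proof. by rewrite finset.in_setU; apply/orP; right; apply/set2P; left. Qed.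

Lemma henneberg_j : [set None; Some j]%SET \in EG.
Proof. by rewrite finset.in_setU; apply/orP; right; apply/set2P; right. Qed.

Lemma henneberg_new_edge (k x : V) :
  ([set None; Some x] = [set None; Some k] :> {set option V})%SET -> x = k.
Proof.
by move=> /setP/(_ (Some x)); rewrite set22 => /esym /set2P[//|[]].
Qed.

Lemma hennebergP u v : [set u; v]%SET \in EG ->
  (exists x y, [/\ u = Some x, v = Some y & [set x; y]%SET \in E]) \/
  ([set u; v]%SET = [set None; Some i]%SET \/
   [set u; v]%SET = [set None; Some j]%SET).
Proof.
rewrite finset.in_setU => /orP[/imsetP[e eE uve]|/set2P[]->];
  [left|by right; left|by right; right].
case: u v uve => [x|] [y|] uve; last 3 first.
- by have := None_notin_Some e; rewrite -uve set22.
- by have := None_notin_Some e; rewrite -uve set21.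
- by have := None_notin_Some e; rewrite -uve set21.
by exists x, y; split=> //; rewrite (Some_imset_inj (etrans (Some_set2 x y) uve)).
Qed.

Lemma restrictE (rho : RG) v :
  val (restrict_realization rho) v = val rho (Some v).
Proof. by rewrite SubK ffunE. Qed.

(** With [a] and [b] in front, unfolding [alg_free] yields at once that [a] and then [b] are
    transcendental over what follows, and that the old labels are free. *)
Lemma henneberg_labels_free :
  alg_free (@rationals F) [:: a, b & labels E v1 v2 lambda'].
Proof.
pose es := [:: [set None; Some i]%SET, [set None; Some j]%SET
  & [seq (Some @: (e : {set V}))%SET | e <- enum (other_edges E v1 v2)]].
have notin k : [set None; Some k]%SET \notin
    [seq (Some @: (e : {set V}))%SET | e <- enum (other_edges E v1 v2)].
  by apply/mapP => -[e _ ek]; have := None_notin_Some e; rewrite -ek set21.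
have -> : [:: a, b & labels E v1 v2 lambda'] = map lambda es.
  by rewrite /= -map_comp.
apply: (alg_independent_free (A := other_edges EG (Some v1) (Some v2))).
- by case: lambda_generic.
- rewrite /= in_cons negb_or !notin map_inj_uniq ?enum_uniq /= ?andbT.
    by apply: contra_neq ij => /henneberg_new_edge.
  exact: Some_imset_inj.
have new k : [set None; Some k]%SET != [set Some v1; Some v2]%SET.
  rewrite -Some_set2.
  apply: contraNneq (None_notin_Some [set v1; v2]%SET) => <-.
  by rewrite set21.
move=> e; rewrite !in_cons => /or3P[/eqP->|/eqP->|/mapP[e' + ->]].
- by apply/setD1P; split; [exact: new|exact: henneberg_i].
- by apply/setD1P; split; [exact: new|exact: henneberg_j].
rewrite mem_enum => /setD1P[ne e'E]; apply/setD1P; split.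
  by rewrite -Some_set2 (inj_eq Some_imset_inj).
exact: henneberg_Some.
Qed.

Lemma labels'_free : alg_free (@rationals F) (labels E v1 v2 lambda').
Proof. by have /and3P[] := henneberg_labels_free. Qed.

Definition gap (r : RG') : F := sqdist (val r i) (val r j).

Lemma gap_neq0 r : gap r != 0.
Proof. exact: (realization_sqdist_neq0 E_simple v1v2E card_E labels'_free). Qed.

Lemma coordinate_field_algebraic x :
  L' x -> x \in alg_span (@rationals F) (labels E v1 v2 lambda').
Proof.
apply: subfield_gen_min => {}x [|[r [v xv]]].
  apply: subfield_gen_min => {}x [e eE <-]; apply: alg_span_mem.
  by apply/mapP; exists e => //; rewrite mem_enum.
have /andP[r1 r2] := realization_algebraic E_simple v1v2E card_E labels'_free r v.
by case: xv => ->.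
Qed.

Definition coord_closed : divringClosed F :=
  subfield_closed (coordinate_field_subfield E v1 v2 lambda').

Lemma coord_closedP x : reflect (L' x) (x \in coord_closed).
Proof. by rewrite mem_subfield_closed; apply: (iffP idP); rewrite inE. Qed.

Lemma b_transcendental : b \notin algebraic_over coord_closed.
Proof.
have /and3P[_ + _] := henneberg_labels_free; apply: contraNN => bL.
apply: algebraic_over_idem; apply: algebraic_over_subset bL => x.
by move/coord_closedP/coordinate_field_algebraic.
Qed.

Lemma a_transcendental : a \notin algebraic_over (adjoin coord_closed b).
Proof.
have /and3P[+ _ _] := henneberg_labels_free; apply: contraNN => aL.
apply: algebraic_over_idem; apply: algebraic_over_subset aL.
apply: adjoin_min; last by apply: alg_span_mem; rewrite mem_head.
move=> x /coord_closedP/coordinate_field_algebraic; apply: alg_span_subset.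
by move=> y; rewrite in_cons => ->; rewrite orbT.
Qed.

Lemma sqdist_new_i (rho : RG) : sqdist (val rho None) (val rho (Some i)) = a.
Proof. by rewrite -(realization_edge rho henneberg_i). Qed.

Lemma sqdist_new_j (rho : RG) : sqdist (val rho None) (val rho (Some j)) = b.
Proof. by rewrite -(realization_edge rho henneberg_j). Qed.

Lemma area_sqr (rho : RG) :
  area_ijn rho ^+ 2 = heron a b (gap (restrict_realization rho)).
Proof. by rewrite signed_area_sqr sqdist_new_i sqdist_new_j /gap !restrictE. Qed.

Lemma realization_new (rho : RG) : val rho None =
  apex (val rho (Some i)) (val rho (Some j)) a b (area_ijn rho).
Proof.
have := gap_neq0 (restrict_realization rho); rewrite /gap !restrictE.
by move/(apexE (val rho None)); rewrite sqdist_new_i sqdist_new_j.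
Qed.

(** The new vertex is a rational expression in [v_i], [v_j], the two new labels and the area. *)
Lemma restrict_area_inj (rho rho' : RG) : equiv_realizations rho rho' ->
  area_ijn rho = area_ijn rho' -> rho = rho'.
Proof.
move=> rr aa; apply/val_inj/ffunP => -[v|]; first exact: rr.
by rewrite !realization_new !rr aa.
Qed.

Lemma equiv_restrict (rho rho' : RG) : equiv_realizations rho rho' <->
  restrict_realization rho = restrict_realization rho'.
Proof.
split=> [e|e v]; first by apply/val_inj/ffunP => v; rewrite !restrictE e.
by rewrite -!restrictE e.
Qed.

(** Each square root of Heron's polynomial is the area of a realization above [r], with the apex as
    new vertex. *)
Lemma lift_realization (r : RG') (A : F) : A ^+ 2 = heron a b (gap r) ->
  exists2 rho : RG, restrict_realization rho = r & area_ijn rho = A.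
Proof.
move=> A2; have [di dj eA] := apexP (gap_neq0 r) A2.
pose f : {ffun option V -> point F} := [ffun o => 
  if o is Some v then val r v else apex (val r i) (val r j) a b A].
have f_ok : compatible EG lambda f && normalized (Some v1) (Some v2) f.
  apply/andP; split; last first.
    by rewrite /normalized !ffunE realization_v1 realization_v2 !eqxx.
  apply/forallP => u; apply/forallP => v; apply/implyP => /hennebergP uv; apply/eqP.
  have new k x y : [set x; y]%SET = [set None; Some k]%SET ->
      sqdist (f x) (f y) = sqdist (f None) (f (Some k)).
    case: x y => [x|] [y|] e.
    - by have := set21 None (Some k); rewrite -e => /set2P[].
    - by rewrite sqdistC; move: e; rewrite finset.setUC => /henneberg_new_edge ->.
    - by move/henneberg_new_edge: e => ->.
    - by have := set22 None (Some k); rewrite -e => /set2P[].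
  case: uv => [[x [y [-> -> xyE]]]|[] e].
  - by rewrite -Some_set2 !ffunE -(realization_edge r xyE).
  - by rewrite (new _ _ _ e) e !ffunE.
  - by rewrite (new _ _ _ e) e !ffunE.
exists (Sub f f_ok).
  by apply/val_inj/ffunP => v; rewrite restrictE SubK ffunE.
by rewrite /area_ijn SubK !ffunE.
Qed.

Lemma restrict_surj (r : RG') : exists rho : RG, restrict_realization rho = r.
Proof.
by have [|rho e _] := @lift_realization r (sqrtC (heron a b (gap r)));
  [rewrite sqrtCK|exists rho].
Qed.

(** The new vertex is reflected in the line through [v_i] and [v_j]. *)
Lemma conj_realization (rho : RG) : exists2 rho' : RG,
  equiv_realizations rho' rho & area_ijn rho' = - area_ijn rho.
Proof.
have [|rho' e ae] := @lift_realization (restrict_realization rho) (- area_ijn rho).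
  by rewrite sqrrN area_sqr.
by exists rho' => //; apply/equiv_restrict.
Qed.

Lemma gap_coord (r : RG') : gap r \in coord_closed.
Proof.
have [/coord_closedP xi /coord_closedP yi] := coordinate_fieldP r i.
have [/coord_closedP xj /coord_closedP yj] := coordinate_fieldP r j.
by rewrite rpredD // rpredX // rpredB.
Qed.

(** The independence of Heron's polynomials in the form that contradicts the conclusion of [kummer].
    The list may repeat values of [gap], as long as that of [rho] is absent. *)
Lemma area_not_square (rho : RG) (s : seq RG) (y : F) :
    {in s, forall rho', gap (restrict_realization rho')
                          != gap (restrict_realization rho)} ->
    y \in adjoin (adjoin coord_closed b) a ->
  y != area_ijn rho * \prod_(rho' <- s) area_ijn rho'.
Proof.
move=> ns yM; apply/eqP => ey.
have := @heron_prod_not_square _ _ _ _ b_transcendental a_transcendental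
  (gap (restrict_realization rho))
  [seq gap (restrict_realization rho') | rho' <- s] y.
rewrite gap_coord gap_neq0 yM => /(_ isT) H.
have : y ^+ 2 == heron a b (gap (restrict_realization rho)) *
    \prod_(e <- [seq gap (restrict_realization rho') | rho' <- s]) heron a b e.
  rewrite ey exprMn area_sqr big_map -prodrXl; apply/eqP; congr (_ * _).
  by apply: eq_bigr => rho' _; rewrite area_sqr.
apply/negP/H => //; first by move=> _ /mapP[rho' _ ->]; exact: gap_coord.
by apply/mapP => -[rho' /ns /eqP + e]; apply.
Qed.

(** An area equal to 0 would lie in [L'(a, b)]: the case of an empty list. *)
Lemma area_neq0 (rho : RG) : area_ijn rho != 0.
Proof.
have := @area_not_square rho [::] 0; rewrite big_nil mulr1 eq_sym; apply=> //.
exact: rpred0.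
Qed.

Lemma psi_restrict (h : RG -> RG) (rho : RG) : Hgroup h ->
  psi h (restrict_realization rho) = restrict_realization (h rho).
Proof.
move=> [_ hE]; rewrite /psi; case: xgetP => [_ -> [rho' /equiv_restrict e <-]|].
  exact/equiv_restrict/hE.
by move=> /(_ (restrict_realization (h rho)))[]; exists rho.
Qed.

Lemma base_field'_sub x : K' x -> K x.
Proof.
move=> K'x; apply/set_mem.
rewrite -(mem_subfield_closed (subfield_gen_subfield _ : subfield K)).
move: x K'x; apply: subfield_gen_min => x [e /setD1P[ne eE] <-].
rewrite mem_subfield_closed inE; apply: base_field_label; apply/setD1P.
split; last exact: henneberg_Some.
by rewrite -Some_set2 (inj_eq Some_imset_inj).
Qed.

Lemma coordinate_field'_sub x : L' x -> L x.
Proof.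
move=> L'x; apply/set_mem.
rewrite -(mem_subfield_closed (subfield_gen_subfield _ : subfield L)).
move: x L'x; apply: subfield_gen_min => x.
case=> [/base_field'_sub/base_field_sub|[r [v xv]]].
  by rewrite mem_subfield_closed inE.
have [rho e] := restrict_surj r; have := coordinate_fieldP rho (Some v).
rewrite -restrictE e mem_subfield_closed inE => -[? ?].
by case: xv => ->.
Qed.

(** Areas are rational in the coordinates, so [s] carries the area of [rho] to that of [h rho]. The
    restriction of [s] maps [L'] onto itself because [psi h] permutes the realizations whose
    coordinates generate [L']. *)
Lemma Gal_henneberg_sub s (h : RG -> RG) :
    Gal EG (Some v1) (Some v2) lambda s -> acts_as s h ->
  [/\ Hgroup h, Gal_perm E v1 v2 lambda' (psi h)
    & forall rho rho' : RG, area_ijn rho = area_ijn rho' ->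
        area_ijn (h rho) = area_ijn (h rho')].
Proof.
move=> sG sh; have lambda1 : lambda [set Some v1; Some v2]%SET = 1.
  by case: lambda_generic.
have [t tG [st ts]] := Gal_inverse sG.
have [h' th'] := Gal_acts lambda1 tG.
have [G cG [sLG GsL]] := Galois_graph
  (coordinate_field_subfield EG (Some v1) (Some v2) lambda) sG.
have rel (rho : RG) o : related G (val rho o) (val (h rho) o).
  by rewrite sh /related; have [Lx Ly] := coordinate_fieldP rho o; rewrite !sLG.
have hK : cancel h h'.
  move=> rho; apply/val_inj/ffunP => o; rewrite th' sh [RHS]surjective_pairing.
  by have [? ?] := coordinate_fieldP rho o; congr pair; rewrite /= st ?inE.
have h'K : cancel h' h.
  move=> rho; apply/val_inj/ffunP => o; rewrite sh th' [RHS]surjective_pairing.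
  by have [? ?] := coordinate_fieldP rho o; congr pair; rewrite /= ts ?inE.
have hH : Hgroup h by split=> [|rho rho' e v]; [exists h'|rewrite !sh e].
have h'H : Hgroup h' by split=> [|rho rho' e v]; [exists h|rewrite !th' e].
have [[sL sinj ssurj] sD sM sK] := sG.
split=> //; last first.
  move=> rho rho' e.
  have := related_area cG (rel rho (Some i)) (rel rho (Some j)) (rel rho None).
  have := related_area cG (rel rho' (Some i)) (rel rho' (Some j)) (rel rho' None).
  rewrite -/(area_ijn rho) -/(area_ijn rho') e => e1 e2.
  exact: coherent_fun cG _ _ _ e2 e1.
have sub := coordinate_field'_sub.
exists s; last first.
  move=> r v; have [rho <-] := restrict_surj r.
  by rewrite psi_restrict // !restrictE sh.
have fixed x : K' x -> (x, x) \in G.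
  move=> /base_field'_sub Kx; have := sLG _ (base_field_sub Kx).
  by rewrite sK // inE.
have psi_bij : bijective (psi h).
  by exists (psi h') => r; have [rho <-] := restrict_surj r;
    rewrite !psi_restrict // ?hK ?h'K.
have rel' (r : RG') v : related G (val r v) (val (psi h r) v).
  by have [rho <-] := restrict_surj r; rewrite psi_restrict // !restrictE.
have [dom ran] := coherent_coordinate_field cG psi_bij fixed rel'.
split.
- split=> [x /dom[y Ly /GsL[_ <-]]//|x y|y /ran[x L'x /GsL[_ ->]]].
    by rewrite !inE => /sub Lx /sub Ly; apply: sinj; rewrite inE.
  by exists x.
- by move=> x y; rewrite !inE => /sub Lx /sub Ly; rewrite sD ?inE.
- by move=> x y; rewrite !inE => /sub Lx /sub Ly; rewrite sM ?inE.
- by move=> x; rewrite inE => /base_field'_sub Kx; rewrite sK ?inE.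
Qed.

(** * Prolonging an automorphism with prescribed signs of the areas *)

Section Extension.
Variable h : RG -> RG.
Hypothesis hH : Hgroup h.
Hypothesis h_area : forall rho rho' : RG, area_ijn rho = area_ijn rho' ->
  area_ijn (h rho) = area_ijn (h rho').

Definition area_pair (rho : RG) : F * F := (area_ijn rho, area_ijn (h rho)).

(** Equal gaps give areas equal up to sign. Equal areas are settled by [h_area]; for opposite ones,
    [h] sends [rho'] and its reflection to two distinct members of one class, whose areas are
    opposite. So one pair for each value of [gap] determines the others. *)
Lemma area_pair_gap (rho rho' : RG) :
    gap (restrict_realization rho) = gap (restrict_realization rho') ->
  area_pair rho = area_pair rho' \/ area_pair rho = - area_pair rho'.
Proof.
move=> e; have : area_ijn rho ^+ 2 == area_ijn rho' ^+ 2 by rewrite !area_sqr e.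
rewrite eqf_sqr => /orP[] /eqP ea; [left|right].
  by rewrite /area_pair ea (h_area ea).
have [rho1 e1 a1] := conj_realization rho'.
have a2 : area_ijn rho = area_ijn rho1 by rewrite ea a1.
rewrite /area_pair ea (h_area a2); congr pair.
have [hbij hE] := hH; have e2 := hE _ _ e1.
have : area_ijn (h rho1) ^+ 2 == area_ijn (h rho') ^+ 2.
  by rewrite !area_sqr (proj1 (equiv_restrict _ _) e2).
rewrite eqf_sqr => /orP[/eqP e3|/eqP //].
have := restrict_area_inj e2 e3 => /(bij_inj hbij) e4.
by move: (area_neq0 rho'); rewrite -eqNr -a1 e4 eqxx.
Qed.

Variable G : divringClosed (F * F)%type.
Hypotheses (cG : coherent G) (GL : forall u, u \in G -> L' u.1 /\ L' u.2).
Hypothesis G_psi : forall (r : RG') v, related G (val r v) (val (psi h r) v).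

Definition label_graph : divringClosed (F * F)%type :=
  adjoin (adjoin G (b, b)) (a, a).

Lemma label_graph_sub : {subset G <= label_graph}.
Proof. by move=> u uG; apply/adjoin_sub/adjoin_sub. Qed.

Lemma label_graph_coherent : coherent label_graph.
Proof.
apply: (@coherent_adjoin_transcendental _ _ (adjoin coord_closed b)).
- apply: (coherent_adjoin_transcendental cG _ b_transcendental).
  by move=> u /GL[/coord_closedP-> /coord_closedP->].
- move=> u uG; rewrite -(preim_predE fst) -(preim_predE snd); apply/andP.
  have uG1 (f : {rmorphism (F * F)%type -> F}) : f (b, b) = b ->
      (forall u, u \in G -> f u \in coord_closed) ->
      u \in preim_pred f (adjoin coord_closed b).
    move=> fb fG; apply: adjoin_min uG => [w wG|].
      by rewrite preim_predE; apply/adjoin_sub/fG.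
    by rewrite preim_predE fb; exact: adjoin_gen.
  by split; apply: uG1 => // w /GL[/coord_closedP ? /coord_closedP ?].
- exact: a_transcendental.
Qed.

Lemma label_graph_fst u : u \in label_graph ->
  u.1 \in adjoin (adjoin coord_closed b) a.
Proof.
rewrite -(preim_predE fst); apply: adjoin_min => [w|]; last exact: adjoin_gen.
apply: adjoin_min => [{}w /GL[/coord_closedP ? _]|].
  by rewrite preim_predE; do 2!apply: adjoin_sub.
by rewrite preim_predE; apply/adjoin_sub/adjoin_gen.
Qed.

Lemma area_pair_sqr rho : area_pair rho ^+ 2 \in label_graph.
Proof.
have -> : area_pair rho ^+ 2 = (heron a b (gap (restrict_realization rho)),
    heron a b (gap (psi h (restrict_realization rho)))).
  by rewrite psi_restrict // -!area_sqr.
apply: (related_heron label_graph_coherent).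
- exact: adjoin_gen.
- exact/adjoin_sub/adjoin_gen.
- exact/label_graph_sub/related_sqdist.
Qed.

Definition area_graph (l : seq RG) : divringClosed (F * F)%type :=
  adjoins label_graph (map area_pair l).

(** If the gap of the new realization already occurs in the list, its pair is an old one up to sign.
    Otherwise its area is new: by [kummer] it would else be, up to a factor in [L'(a, b)], a product
    of areas with other gaps. *)
Lemma area_graph_coherent l : coherent (area_graph l).
Proof.
elim: l => [|rho l IH]; first exact: label_graph_coherent.
have base := @adjoins_base _ label_graph (map area_pair l).
have [/hasP[rho' rho'l /eqP e]|/hasPn nl] := boolP (has (fun rho' =>
    gap (restrict_realization rho') == gap (restrict_realization rho)) l).
  have rho'G : area_pair rho' \in area_graph l by apply/adjoins_mem/map_f.
  move=> u uG; apply: IH; apply: adjoin_min uG => //.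
  by case: (area_pair_gap (esym e)) => ->; rewrite ?rpredN.
apply: (coherent_adjoin_quadratic IH); first exact/base/area_pair_sqr.
move=> u uG; apply/eqP => /= u1.
have : area_ijn rho \in adjoins (adjoin (adjoin coord_closed b) a)
    [seq area_ijn rho' | rho' <- l].
  rewrite -u1 -(preim_predE fst).
  apply: adjoins_min uG => [w wG|_ /mapP[rho' rho'l ->]].
    by rewrite preim_predE; apply/adjoins_base/label_graph_fst.
  by rewrite preim_predE; apply: adjoins_mem; apply: map_f.
have sqr (rho' : RG) : area_ijn rho' ^+ 2 \in adjoin (adjoin coord_closed b) a.
  exact: label_graph_fst (area_pair_sqr rho').
case/kummer => [_ /mapP[rho' _ ->]//|//|m].
rewrite -map_mask big_map => /(area_not_square (rho := rho) (s := mask m l)).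
by rewrite eqxx => /(_ _)/negP[] // rho' /mem_mask /nl.
Qed.

(** A union directed by concatenation of lists, so closure and coherence reduce to finitely many
    areas at a time. *)
Definition area_graphs : {pred F * F} :=
  fun u => `[< exists l, u \in area_graph l >].

Lemma area_graph_cat l l' : {subset area_graph l <= area_graph (l ++ l')} /\
  {subset area_graph l' <= area_graph (l ++ l')}.
Proof.
split; apply: adjoins_subset => u /mapP[rho rl ->]; apply: map_f;
  by rewrite mem_cat rl ?orbT.
Qed.

Fact area_graphs_divring : divring_closed area_graphs.
Proof.
split.
- by apply/asboolP; exists [::]; exact: rpred1.
- move=> u v /asboolP[l /(area_graph_cat l _).1 ul] /asboolP[l' vl].
  apply/asboolP; exists (l ++ l'); rewrite rpredB ?ul //.
  exact: (area_graph_cat l l').2.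
- move=> u v /asboolP[l /(area_graph_cat l _).1 ul] /asboolP[l' vl].
  apply/asboolP; exists (l ++ l'); rewrite rpred_div ?ul //.
  exact: (area_graph_cat l l').2.
Qed.
HB.instance Definition _ := GRing.isDivringClosed.Build (F * F)%type area_graphs
  area_graphs_divring.

Lemma area_graphs_coherent : coherent area_graphs.
Proof. by move=> u /asboolP[l]; exact: area_graph_coherent. Qed.

Lemma area_graphs_related (rho : RG) o :
  related area_graphs (val rho o) (val (h rho) o).
Proof.
have sub : {subset label_graph <= area_graphs}.
  by move=> u uG; apply/asboolP; exists [::].
have rel v : related area_graphs (val rho (Some v)) (val (h rho) (Some v)).
  have /andP[x y] := G_psi (restrict_realization rho) v.
  rewrite psi_restrict // !restrictE in x y.
  by apply/andP; split; exact/sub/label_graph_sub.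
case: o => // ; rewrite !realization_new.
apply: related_apex => //.
- exact: area_graphs_coherent.
- exact/sub/adjoin_gen.
- exact/sub/adjoin_sub/adjoin_gen.
- by apply/asboolP; exists [:: rho]; exact: adjoin_gen.
Qed.

End Extension.

Lemma Gal_henneberg_sup (h : RG -> RG) : Hgroup h ->
    Gal_perm E v1 v2 lambda' (psi h) ->
    (forall rho rho' : RG, area_ijn rho = area_ijn rho' ->
        area_ijn (h rho) = area_ijn (h rho')) ->
  exists2 s, Gal EG (Some v1) (Some v2) lambda s & acts_as s h.
Proof.
move=> hH [s sG s_psi] h_area.
have [G cG [sLG GsL]] := Galois_graph
  (coordinate_field_subfield E v1 v2 lambda') sG.
have [[sL _ _] _ _ sK] := sG.
have GL u : u \in G -> L' u.1 /\ L' u.2.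
  by case: u => x y /GsL[Lx ->]; split=> //; exact: sL.
have G_psi (r : RG') v : related G (val r v) (val (psi h r) v).
  by rewrite s_psi /related; have [Lx Ly] := coordinate_fieldP r v; rewrite !sLG.
pose H : divringClosed (F * F)%type := area_graphs h G.
have cH : coherent H := area_graphs_coherent hH h_area cG GL G_psi.
have rel := area_graphs_related hH h_area cG GL G_psi.
have sub : {subset label_graph G <= H}.
  by move=> u uG; apply/asboolP; exists [::].
have fixed x : K x -> (x, x) \in H.
  apply: (coherent_diagonal cH) => {}x [e /setD1P[ne eE] <-].
  move: eE; rewrite finset.in_setU => /orP[/imsetP[e' e'E ee]|/set2P[]->].
  - apply/sub/label_graph_sub; have Ke : K' (lambda e).
      rewrite ee; apply: (base_field_label (lambda := lambda')).
      apply/setD1P; split=> //.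
      by move: ne; rewrite ee -Some_set2 (inj_eq Some_imset_inj).
    by have := sLG _ (base_field_sub Ke); rewrite sK ?inE.
  - exact/sub/adjoin_gen.
  - exact/sub/adjoin_sub/adjoin_gen.
have [dom ran] := coherent_coordinate_field cH (proj1 hH) fixed rel.
have KG x : K x -> L x /\ (x, x) \in H.
  by move=> Kx; split; [exact: base_field_sub|exact: fixed].
have [t tG tP] := coherent_Galois cH dom ran KG
  (coordinate_field_subfield EG (Some v1) (Some v2) lambda).
exists t => // rho o; have [Lx Ly] := coordinate_fieldP rho o.
have /andP[r1 r2] := rel rho o; rewrite [LHS]surjective_pairing.
by congr pair;
  [apply: coherent_fun cH _ _ _ r1 _|apply: coherent_fun cH _ _ _ r2 _]; exact: tP.
Qed.

End Henneberg.

(** [Phi] sends a representative of a Galois element to its permutation of the realizations. It is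
    multiplicative, injective modulo equality on the coordinate field, and has the described image:
    an isomorphism of permutation groups. *)
Theorem theorem2 (R : realType) (V : finType) (E : {set {set V}})
    (v1 v2 i j : V) (lambda : {set option V} -> R[i]) :
  simple_graph E -> minimally_rigid E -> ([set v1; v2]%SET \in E) -> i != j ->
  generic_labelling (henneberg1 E i j) (Some v1) (Some v2) lambda ->
  let RG := realizations (henneberg1 E i j) (Some v1) (Some v2) lambda in
  let GalG := Gal (henneberg1 E i j) (Some v1) (Some v2) lambda in
  let GalG' := Gal_perm E v1 v2 (restrict_labelling lambda) in
  exists Phi : (R[i] -> R[i]) -> RG -> RG,
    [/\ forall s, GalG s -> acts_as s (Phi s),
        forall s t, GalG s -> GalG t -> Phi (s \o t) = Phi s \o Phi t,
        forall s t, GalG s -> GalG t -> Phi s = Phi t ->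
          {in coordinate_field (henneberg1 E i j) (Some v1) (Some v2) lambda,
            s =1 t}
      & (Phi @` GalG =
         [set h | [/\ Hgroup h, GalG' (psi h)
            & forall rho rho' : RG, area_ijn rho = area_ijn rho' ->
                area_ijn (h rho) = area_ijn (h rho')]])%classic].
Proof.
move=> Es [card_E _] v12 ij gen RG GalG GalG'.
have lambda1 : lambda [set Some v1; Some v2]%SET = 1 by case: gen.
have /choice[Phi PhiP] (s : R[i] -> R[i]) :
    exists h : RG -> RG, GalG s -> acts_as s h.
  have [/(Gal_acts lambda1)[h sh]|nG] := pselect (GalG s); first by exists h.
  by exists id.
exists Phi; split=> //.
- move=> s t sG tG; apply: (@acts_as_inj _ _ _ _ _ _ (s \o t)).
    by apply: PhiP; exact: Gal_comp.
  by move=> rho v; rewrite /= PhiP // PhiP.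
- move=> s t sG tG e; have := PhiP t tG; rewrite -e.
  exact: Gal_faithful sG tG (PhiP s sG).
- apply/seteqP; split=> [_ [s sG <-]|h [hH hpsi harea]].
    exact: Gal_henneberg_sub Es card_E v12 ij gen _ _ sG (PhiP s sG).
  have [s sG sh] := Gal_henneberg_sup Es card_E v12 ij gen hH hpsi harea.
  by exists s => //; apply: acts_as_inj (PhiP s sG) sh.
Qed.
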